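(* Consider a polyhedral surface $m$ with Gauss image $s$, and assume that for each face $f\in F$ the mean and Gaussian curvatures $H_f$, $K_f$ are defined. Regarding the existence of the principal curvatures $\kappa_{1,f}$ and $\kappa_{2,f}$, we have the following statements: 1. For a quadrilateral $f$, $\kappa_{1,f}=\kappa_{2,f}$ if and only if $m(f)$, $s(f)$ are related by a similarity. If this is not the case, $\kappa_{1,f},\kappa_{2,f}$ exist if and only if the vertices of $m(f)$ or of $s(f)$ lie on the boundary of their convex hull. 2. Suppose some linear combination of the $n$-gons $m(f)$, $s(f)$ is the boundary cycle of a strictly convex polygon. Then $\kappa_{1,f},\kappa_{2,f}$ exist, and $\kappa_{1,f}=\kappa_{2,f}$ if and only if $m(f)$ and $s(f)$ are related by a similarity transform. 3. Suppose $f$ is a quadrilateral and the Gauss image $s$ is inscribed in a strictly convex surface $\Sigma$. Then principal curvatures exist. They are equal if and only if $m(f)$ and $s(f)$ are related by a similarity transform.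
   Context: Mesh combinatorics: a 2-dimensional cell complex $(V,E,F)$. A mesh is a map $m:V\to\mathbb{R}^3$, $i\mapsto m_i$; for a face $f=(i_1,\dots,i_n)$, $m(f)$ denotes the $n$-gon $(m_{i_1},\dots,m_{i_n})$. A mesh is a polyhedral surface if all vertices belonging to a face are mapped to coplanar points. Meshes $m,s$ with the same combinatorics are parallel if for each edge $(i,j)\in E$ the vectors $m_i-m_j$ and $s_i-s_j$ are linearly dependent. A Gauss image $s$ of a polyhedral surface $m$ is here an arbitrary mesh parallel to $m$; for each face $f$, the $n$-gons $m(f)$ and $s(f)$ lie in planes parallel to some 2-dimensional subspace $U_f$. Linear combinations of polygons are taken vertex-wise. For an $n$-gon $P=(p_0,\dots,p_{n-1})$ in $U_f$, $A(P)=\frac12\sum_{0\le i<n}\det(p_i,p_{i+1})$ is its oriented area (indices modulo $n$, $\det$ a determinant form in $U_f$), and $A(P,Q)$ is the associated symmetric bilinear form. The mean and Gaussian curvatures of the face $f$ of $m$ with respect to $s$ are $H_f=-A(m(f),s(f))/A(m(f))$ and $K_f=A(s(f))/A(m(f))$; they are defined only for faces of nonvanishing area. The principal curvatures $\kappa_{1,f},\kappa_{2,f}$ of $f$ are the zeros of the quadratic polynomial $x^2-2H_fx+K_f$; they exist if this polynomial factorizes over $\mathbb{R}$. A mesh is inscribed in $\Sigma$ if its vertices lie on $\Sigma$.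
   Formalization: Similarities preserve orientation, with ratio 0 allowed; in 1, equality assumes some linear combination of m(f), s(f) has independent consecutive edges, and existence assumes this of both m(f) and s(f); in 3, consecutive vertices of s(f) are assumed distinct. *)

(* Defs.v *)
From HB Require Import structures.
From mathcomp Require Import all_boot all_order all_algebra.
From mathcomp Require Import all_classical all_reals all_analysis.
Import Order.TTheory GRing.Theory Num.Theory numFieldNormedType.Exports.

Set Implicit Arguments.
Unset Strict Implicit.
Unset Printing Implicit Defensive.

Local Open Scope classical_set_scope.
Local Open Scope ring_scope.

(* Only the incidences of a 2-dimensional cell complex (V,E,F) matter: which
   pairs of vertices are joined by an edge, and for each face the cyclic list
   (i_1, ..., i_n) of its vertices, consecutive ones being joined by an edge.
   [ordS] is the cyclic successor in 'I_n. *)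
Record mesh_combinatorics := MeshCombinatorics {
  vertex : Type;
  edge : rel vertex;
  face : Type;
  arity : face -> nat;
  corner : forall f : face, 'I_(arity f) -> vertex;
  edge_symmetric : symmetric edge;
  arity_ge3 : forall f, (3 <= arity f)%N;
  corner_edge : forall (f : face) (i : 'I_(arity f)),
    edge (corner i) (corner (ordS i))
}.

Definition mesh (R : realType) (C : mesh_combinatorics) : Type :=
  vertex C -> 'rV[R]_3.

(* An n-gon in R^3 is an n x 3 matrix whose rows are its vertices, so that
   vertex-wise linear combinations are those of matrices. *)
Definition face_polygon (R : realType) (C : mesh_combinatorics)
    (m : mesh R C) (f : face C) : 'M[R]_(arity f, 3) :=
  \matrix_(i < arity f) m (corner i).

Section Polygons.
Variables (R : realType) (n : nat).
Implicit Types (P Q : 'M[R]_(n, 3)) (U : {vspace 'rV[R]_3}) (w : 'rV[R]_3).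

Definition in_plane_parallel_to U P : Prop :=
  forall i j : 'I_n, row i P - row j P \in U.

Definition polygon_edge P (i : 'I_n) : 'rV[R]_3 := row (ordS i) P - row i P.

(* Every vertex is an actual corner: neither edge at it is zero, and the two
   edges are not parallel. For n = 4: no three of the vertices are collinear. *)
Definition nondegenerate_polygon P : Prop :=
  forall i : 'I_n, free [:: polygon_edge P i; polygon_edge P (ordS i)].

(* For a 2-dimensional U, the determinant forms in U are the restrictions to U
   of the forms (u, v) |-> det(u, v, w) with w outside of U. *)
Definition det_form w (u v : 'rV[R]_3) : R :=
  \det (col_mx u (col_mx v w) : 'M[R]_3).

(* [det_form w] is alternating and bilinear on all of R^3, hence this sum is
   invariant under translations of P; so it is the area in U of any translate
   of P contained in U. *)
Definition area w P : R :=
  2^-1 * \sum_(i < n) det_form w (row i P) (row (ordS i) P).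

Definition mixed_area w P Q : R :=
  2^-1 * (area w (P + Q) - area w P - area w Q).

(* P = m(f), Q = s(f); [det_form w] and [det_form (c *: w)] give the same
   curvatures. *)
Definition mean_curvature w P Q : R := - mixed_area w P Q / area w P.
Definition gauss_curvature w P Q : R := area w Q / area w P.

Definition curvature_poly w P Q : {poly R} :=
  'X^2 - (2 * mean_curvature w P Q) *: 'X + (gauss_curvature w P Q)%:P.

Definition are_principal_curvatures w P Q (k1 k2 : R) : Prop :=
  curvature_poly w P Q = ('X - k1%:P) * ('X - k2%:P).

Definition principal_curvatures_exist w P Q : Prop :=
  exists k1 k2 : R, are_principal_curvatures w P Q k1 k2.

(* Rotation about an axis orthogonal to U (acting on row vectors). *)
Definition plane_rotation U (T : 'M[R]_3) : Prop :=
  [/\ T *m T^T = 1%:M, \det T = 1 &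
      forall v : 'rV[R]_3, (forall u, u \in U -> v *m u^T = 0) -> v *m T = v].

(* Q is the image of P under a similarity of planes parallel to U. Similarities
   preserve the orientation of U (a rectangle and its reflection in one of its
   sides are parallel, but have principal curvatures 1 and -1). The ratio
   may be 0, i.e. Q may be a single point; then both principal curvatures
   are 0. *)
Definition related_by_similarity U P Q : Prop :=
  exists (r : R) (T : 'M[R]_3) (t : 'rV[R]_3),
    [/\ 0 <= r, plane_rotation U T &
        forall i : 'I_n, row i Q = r *: (row i P *m T) + t].

Definition hull P : set 'rV[R]_3 :=
  [set x | exists c : 'rV[R]_n,
     [/\ forall i, 0 <= c ord0 i, \sum_(i < n) c ord0 i = 1 & x = c *m P]].

(* The boundary is taken relative to the plane of P, which is parallel to U. *)
Definition vertices_on_hull_boundary U P : Prop :=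
  forall i : 'I_n,
    ~ (\forall x \near row i P, x - row i P \in U -> hull P x).

(* For every edge, all other vertices lie strictly on one side of the line
   spanned by it. *)
Definition strictly_convex_polygon w P : Prop :=
  forall i : 'I_n,
    (forall j : 'I_n, j != i -> j != ordS i ->
       0 < det_form w (polygon_edge P i) (row j P - row i P)) \/
    (forall j : 'I_n, j != i -> j != ordS i ->
       det_form w (polygon_edge P i) (row j P - row i P) < 0).

End Polygons.

Section Meshes.
Variables (R : realType) (C : mesh_combinatorics).
Implicit Types m s : mesh R C.

Definition polyhedral_surface m : Prop :=
  forall f, exists2 U : {vspace 'rV[R]_3},
    \dim U = 2%N & in_plane_parallel_to U (face_polygon m f).

Definition parallel_meshes m s : Prop :=
  forall i j : vertex C, edge i j -> ~~ free [:: m i - m j; s i - s j].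

Definition inscribed s (Sigma : set 'rV[R]_3) : Prop :=
  forall i : vertex C, Sigma (s i).

End Meshes.

(* The boundary of a closed strictly convex body, not necessarily bounded. *)
Definition strictly_convex_surface (R : realType) (Sigma : set 'rV[R]_3) : Prop :=
  exists K : set 'rV[R]_3,
    [/\ closed K, interior K !=set0,
        forall (x y : 'rV[R]_3) (t : R), K x -> K y -> x != y -> 0 < t < 1 ->
          interior K (t *: x + (1 - t) *: y)
      & Sigma = closure K `\` interior K].

(* Main.v *)
Require Import Defs.
From HB Require Import structures.
From mathcomp Require Import all_boot all_order all_algebra.
From mathcomp Require Import all_classical all_reals all_analysis.
From mathcomp Require Import zify ring lra.
Import Order.TTheory GRing.Theory Num.Theory numFieldNormedType.Exports.

(** The principal curvatures are the zeros of a quadratic polynomial whose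
    multiple by area P is area (x P + Q), for P = m(f) and Q = s(f). They exist
    if and only if [area_disc], the discriminant of the area form on the pencil
    spanned by P and Q, is nonnegative, and coincide if and only if it vanishes.

    A similarity between parallel polygons maps some edge to a multiple of
    itself, so its rotational part is the identity or a half-turn of the plane
    ([rotation_eigenvector]). Hence similar means that Q = a P + t, with a of any
    sign, and in this case the area form has rank one and the discriminant is 0.
    What has to be shown is that the discriminant is nonnegative, and that it
    vanishes only for proportional P and Q.

    Quadrilaterals. Let N be a member of the pencil, with pairwise independent
    consecutive edges. The quadrilaterals parallel to N form a plane, up to
    translations. The discriminant of the area form on this plane is, up to a
    positive factor, the product of the four determinants of consecutive edges
    of N, the turns ([quad_area_disc]). So it does not vanish, and the
    discriminant of P and Q, if they are not proportional, has its sign. Up to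
    sign, the turns are also the coefficients of the affine dependence of the
    vertices. Their product is negative if and only if one vertex lies inside
    the triangle formed by the others ([quad_hull_boundary]). If Q is inscribed
    in a strictly convex surface, this is impossible: a vertex inside such a
    triangle would lie in the interior of the convex body
    ([inscribed_turn_prod]).

    Strictly convex n-gons. Let N be a strictly convex member of the pencil, so
    that its area does not vanish; orient the plane to make it positive. It
    suffices to find a member Y of nonpositive area. Choose a height function on
    the plane which is constant on no edge of N. For every Y parallel to N,
    summation by parts gives the area of Y as a weighted sum of the squared
    heights of its vertices ([area_heights]), where the weights are negative
    except at the lowest and the highest vertex of N. The pencil contains a
    member Y for which these two vertices have the same height. Measuring the
    heights from there, only negative weights are left, and the area of Y is
    negative unless Y is a single point ([pencil_nonpos_area]). In the latter
    case P and Q are proportional. *)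

Set Implicit Arguments.
Unset Strict Implicit.
Unset Printing Implicit Defensive.

Local Open Scope classical_set_scope.
Local Open Scope ring_scope.

(** * Determinant forms on a plane in space *)

Notation ord3_0 := (@Ordinal 3 0 isT).
Notation ord3_1 := (@Ordinal 3 1 isT).
Notation ord3_2 := (@Ordinal 3 2 isT).

Section DetForm.
Variable R : realType.
Implicit Types u v w z : 'rV[R]_3.

Lemma sum_ord3 (F : 'I_3 -> R) : \sum_i F i = F ord3_0 + F ord3_1 + F ord3_2.
Proof.
rewrite !big_ord_recl big_ord0 addr0 addrA.
by congr (F _ + F _ + F _); apply/val_inj.
Qed.

Lemma row3P u v :
  u 0 ord3_0 = v 0 ord3_0 -> u 0 ord3_1 = v 0 ord3_1 ->
  u 0 ord3_2 = v 0 ord3_2 -> u = v.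
Proof.
move=> e0 e1 e2; apply/rowP => -[[|[|[|//]]] i3].
- by rewrite (_ : Ordinal i3 = ord3_0) //; apply/val_inj.
- by rewrite (_ : Ordinal i3 = ord3_1) //; apply/val_inj.
- by rewrite (_ : Ordinal i3 = ord3_2) //; apply/val_inj.
Qed.

Lemma det3E (A : 'M[R]_3) : \det A =
  A ord3_0 ord3_0 *
    (A ord3_1 ord3_1 * A ord3_2 ord3_2 - A ord3_1 ord3_2 * A ord3_2 ord3_1)
  - A ord3_0 ord3_1 *
    (A ord3_1 ord3_0 * A ord3_2 ord3_2 - A ord3_1 ord3_2 * A ord3_2 ord3_0)
  + A ord3_0 ord3_2 *
    (A ord3_1 ord3_0 * A ord3_2 ord3_1 - A ord3_1 ord3_1 * A ord3_2 ord3_0).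
Proof.
rewrite (expand_det_row _ ord3_0) sum_ord3 /cofactor.
rewrite !(expand_det_row _ (@Ordinal 2 0 isT)) !big_ord_recl !big_ord0.
rewrite /cofactor !det_mx11 !mxE.
pose a i j := A (inord i) (inord j).
have aE i j : A i j = a (val i) (val j) by rewrite /a !inord_val.
by rewrite !aE /= /bump /=; ring.
Qed.

Lemma col3E u v w j : [/\ col_mx u (col_mx v w) ord3_0 j = u 0 j,
  col_mx u (col_mx v w) ord3_1 j = v 0 j &
  col_mx u (col_mx v w) ord3_2 j = w 0 j].
Proof.
split.
- by rewrite -(col_mxEu u (col_mx v w)); congr (col_mx _ _ _ _); apply/val_inj.
- rewrite -(col_mxEu v w) -(col_mxEd u (col_mx v w)).
  by congr (col_mx _ _ _ _); apply/val_inj.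
- rewrite -(col_mxEd v w) -(col_mxEd u (col_mx v w)).
  by congr (col_mx _ _ _ _); apply/val_inj.
Qed.

Lemma det_formE w u v : det_form w u v =
  u 0 ord3_0 * (v 0 ord3_1 * w 0 ord3_2 - v 0 ord3_2 * w 0 ord3_1)
  - u 0 ord3_1 * (v 0 ord3_0 * w 0 ord3_2 - v 0 ord3_2 * w 0 ord3_0)
  + u 0 ord3_2 * (v 0 ord3_0 * w 0 ord3_1 - v 0 ord3_1 * w 0 ord3_0).
Proof.
rewrite /det_form det3E.
by do 3![rewrite !(fun j => let: And3 e _ _ := col3E u v w j in e)
  |rewrite !(fun j => let: And3 _ e _ := col3E u v w j in e)
  |rewrite !(fun j => let: And3 _ _ e := col3E u v w j in e)].
Qed.

Lemma det_formDl w u u' v :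
  det_form w (u + u') v = det_form w u v + det_form w u' v.
Proof. by rewrite !det_formE !mxE; ring. Qed.

Lemma det_formZl w a u v : det_form w (a *: u) v = a * det_form w u v.
Proof. by rewrite !det_formE !mxE; ring. Qed.

Lemma det_formC w u v : det_form w u v = - det_form w v u.
Proof. by rewrite !det_formE; ring. Qed.

Lemma det_formvv w u : det_form w u u = 0.
Proof. by rewrite !det_formE; ring. Qed.

Lemma det_formNl w u v : det_form w (- u) v = - det_form w u v.
Proof. by rewrite -scaleN1r det_formZl mulN1r. Qed.

Lemma det_formBl w u u' v :
  det_form w (u - u') v = det_form w u v - det_form w u' v.
Proof. by rewrite det_formDl det_formNl. Qed.

Lemma det_formDr w u v v' :
  det_form w u (v + v') = det_form w u v + det_form w u v'.
Proof. by rewrite !(det_formC w u) det_formDl opprD. Qed.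

Lemma det_formZr w a u v : det_form w u (a *: v) = a * det_form w u v.
Proof. by rewrite !(det_formC w u) det_formZl mulrN. Qed.

Lemma det_formNr w u v : det_form w u (- v) = - det_form w u v.
Proof. by rewrite !(det_formC w u) det_formNl. Qed.

Lemma det_formBr w u v v' :
  det_form w u (v - v') = det_form w u v - det_form w u v'.
Proof. by rewrite det_formDr det_formNr. Qed.

Lemma det_form0l w v : det_form w 0 v = 0.
Proof. by rewrite -(scale0r 0) det_formZl mul0r. Qed.

Lemma det_form0r w v : det_form w v 0 = 0.
Proof. by rewrite det_formC det_form0l oppr0. Qed.

Lemma det_form_sumr w u I (r : seq I) (p : pred I) (F : I -> 'rV[R]_3) :
  det_form w u (\sum_(i <- r | p i) F i) = \sum_(i <- r | p i) det_form w u (F i).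
Proof.
elim/big_rec2: _ => [|i y x _ <-]; first exact: det_form0r.
exact: det_formDr.
Qed.

Lemma det_form_oppw w u v : det_form (- w) u v = - det_form w u v.
Proof. by rewrite !det_formE !mxE; ring. Qed.

Lemma free_pairP u v :
  reflect (forall a b : R, a *: u + b *: v = 0 -> a = 0 /\ b = 0)
          (free [:: u; v]).
Proof.
apply: (iffP idP) => [|uv].
  rewrite free_cons seq1_free span_seq1 => /andP[uNv v0] a b /eqP.
  rewrite addr_eq0 => /eqP uv; have a0 : a = 0.
    apply/eqP; apply: contraR uNv => a0.
    rewrite -[u](scalerK a0) uv scalerN rpredN rpredZ// rpredZ//.
    exact: memv_line.
  split=> //; move/esym/eqP: uv; rewrite a0 scale0r oppr_eq0 scaler_eq0.
  by rewrite (negPf v0) orbF => /eqP.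
rewrite free_cons seq1_free span_seq1; apply/andP; split.
  apply/negP => /vlineP[k uE].
  have [] := uv 1 (- k); first by rewrite uE scale1r scaleNr subrr.
  by move/eqP; rewrite oner_eq0.
apply/eqP => v0; have [] := uv 0 1; first by rewrite v0 scale0r scaler0 addr0.
by move=> _ /eqP; rewrite oner_eq0.
Qed.

Lemma free_pairPn u v : ~~ free [:: u; v] ->
  exists a b : R, (a, b) != (0, 0) /\ a *: u + b *: v = 0.
Proof.
move/negP => nf; apply: contrapT => nab; apply: nf; apply/free_pairP => a b ab.
have [[-> ->] //|ab0] := eqVneq (a, b) (0, 0).
by case: nab; exists a, b.
Qed.

(** This expresses the edges of two parallel polygons through those of a
    combination of them, even where one of the two has edges of length zero. *)
Lemma parallel_combination a b u v : ~~ free [:: u; v] ->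
  a *: u + b *: v != 0 ->
  exists l m : R, u = l *: (a *: u + b *: v) /\ v = m *: (a *: u + b *: v).
Proof.
move=> /free_pairPn[c [d [cd0 cd]]] e0.
have [x [y [e [ex ey]]]] :
    exists x y : R, exists e, u = x *: e /\ v = y *: e.
  have [c0|c0] := eqVneq c 0.
    have d0 : d != 0 by apply: contraNneq cd0 => ->; rewrite c0.
    exists 1, 0, u; split; rewrite ?scale1r// scale0r.
    move/eqP: cd; rewrite c0 scale0r add0r scaler_eq0 (negPf d0) /=.
    by move/eqP.
  exists (- (c^-1 * d)), 1, v; split; rewrite ?scale1r//.
  apply: (scalerI c0); rewrite scalerA mulrN mulrA divff// mul1r scaleNr.
  by apply/eqP; rewrite -addr_eq0 cd.
rewrite ex ey in e0 *.
move: e0; rewrite !scalerA -scalerDl scaler_eq0 negb_or => /andP[k0 _].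
exists (x / (a * x + b * y)), (y / (a * x + b * y)).
by rewrite !scalerA !mulfVK.
Qed.

Definition cross u v : 'rV[R]_3 :=
  \row_j (if val j == 0%N then
            u 0 ord3_1 * v 0 ord3_2 - u 0 ord3_2 * v 0 ord3_1
          else if val j == 1%N then
            u 0 ord3_2 * v 0 ord3_0 - u 0 ord3_0 * v 0 ord3_2
          else u 0 ord3_0 * v 0 ord3_1 - u 0 ord3_1 * v 0 ord3_0).

Definition dot u v : R := (u *m v^T) 0 0.

Lemma dotE u v : dot u v =
  u 0 ord3_0 * v 0 ord3_0 + u 0 ord3_1 * v 0 ord3_1 + u 0 ord3_2 * v 0 ord3_2.
Proof. by rewrite /dot mxE sum_ord3 !mxE. Qed.

Lemma dot_eq0 u v : dot u v = 0 -> u *m v^T = 0.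
Proof. by move=> uv; apply/rowP => i; rewrite ord1 [RHS]mxE; exact: uv. Qed.

Lemma dotvv_eq0 u : (dot u u == 0) = (u == 0).
Proof.
apply/eqP/eqP => [|->]; last by rewrite dotE !mxE; ring.
by rewrite dotE => uu; apply: row3P; rewrite !mxE; nra.
Qed.

Section Plane.
Variables (U : {vspace 'rV[R]_3}).
Hypothesis dimU : \dim U = 2%N.

Lemma plane_basis : exists b c, [/\ b \in U, c \in U, free [:: b; c] &
  forall z, z \in U -> exists x y : R, z = x *: b + y *: c].
Proof.
have /andP[/eqP sp fr] := vbasisP U.
case: (vbasis U) sp fr => /= s; rewrite dimU.
case: s => [//|b [//|c [|//]]] _ sp fr.
have inU z : (z \in [:: b; c]) -> z \in U by rewrite -sp; exact: memv_span.
exists b, c; split=> //; [by rewrite inU// !inE eqxx|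
  by rewrite inU// !inE eqxx orbT|].
move=> z; rewrite -sp span_cons span_seq1 => /memv_addP[_ /vlineP[x ->]].
by case=> _ /vlineP[y ->] ->; exists x, y.
Qed.

Lemma det_form_plane u v z : u \in U -> v \in U -> z \in U -> det_form z u v = 0.
Proof.
have [b [c [_ _ _ bc]]] := plane_basis.
move=> /bc[x [y ->]] /bc[x' [y' ->]] /bc[x'' [y'' ->]].
by rewrite !det_formE !mxE; ring.
Qed.

(** This is the relation between the four vectors u, v, w, z of space given by
    Cramer's rule, in which the coefficient det (u, v, z) of w vanishes. *)
Lemma det_form_cramer w u v z : u \in U -> v \in U -> z \in U ->
  det_form w u v *: z = det_form w z v *: u + det_form w u z *: v.
Proof.
move=> uU vU zU.
have : det_form z u v *: w = 0 by rewrite det_form_plane// scale0r.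
move=> e; rewrite -[RHS]addr0 -[in RHS]e.
by apply: row3P; rewrite !det_formE !mxE; ring.
Qed.

Lemma det_form_plucker w u v z t : u \in U -> v \in U -> z \in U ->
  det_form w u v * det_form w z t =
  det_form w z v * det_form w u t + det_form w u z * det_form w v t.
Proof.
move=> uU vU zU; rewrite -!det_formZl -det_formDl.
by rewrite (det_form_cramer w uU vU zU).
Qed.

Lemma det_form_eq0 w u v : w \notin U -> u \in U -> v \in U ->
  (det_form w u v == 0) = ~~ free [:: u; v].
Proof.
move=> wU uU vU; apply/idP/idP => [/eqP d0|/free_pairPn[a [b [ab0 ab]]]].
  (* x lists the coefficients of a linear relation between u, v and w. *)
  have /eqP/det0P[x x0 xE] := d0.
  have e j : x 0 ord3_0 * u 0 j + x 0 ord3_1 * v 0 j + x 0 ord3_2 * w 0 j = 0.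
    have [<- <- <-] := col3E u v w j.
    by move/rowP: xE => /(_ j); rewrite mxE [RHS]mxE sum_ord3.
  have {}e : x 0 ord3_0 *: u + x 0 ord3_1 *: v + x 0 ord3_2 *: w = 0.
    by apply: row3P; rewrite !mxE e.
  (* The coefficient of w vanishes, as w lies outside of the plane. *)
  have x2 : x 0 ord3_2 = 0.
    apply/eqP; apply: contraNT wU => x2.
    rewrite -[w](scalerK x2) memvZ// -(memvN U) -sub0r -e.
    by rewrite addrK memvD// memvZ.
  apply: contra_neqN x0 => /free_pairP/(_ (x 0 ord3_0) (x 0 ord3_1)) fr.
  have [|x0 x1] := fr; first by rewrite -e x2 scale0r addr0.
  by apply: row3P; rewrite ?mxE.
have e t : a * det_form w u t + b * det_form w v t = 0.
  by rewrite -!det_formZl -det_formDl ab det_form0l.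
have [a0|a0] := eqVneq a 0.
  have := e u; rewrite a0 mul0r add0r => /eqP; rewrite mulf_eq0.
  case/orP => [/eqP b0|]; first by rewrite a0 b0 eqxx in ab0.
  by rewrite det_formC oppr_eq0.
have := e v; rewrite det_formvv mulr0 addr0 => /eqP.
by rewrite mulf_eq0 (negPf a0).
Qed.

End Plane.
End DetForm.

(** * Similarities of parallel polygons *)

Section Similarity.
Variable R : realType.
Implicit Types u v w k : 'rV[R]_3.

Lemma dotC u v : dot u v = dot v u.
Proof. by rewrite !dotE; ring. Qed.

Lemma dotDl u v w : dot (u + v) w = dot u w + dot v w.
Proof. by rewrite !dotE !mxE; ring. Qed.

Lemma dotZl a u w : dot (a *: u) w = a * dot u w.
Proof. by rewrite !dotE !mxE; ring. Qed.

Lemma dot_isometry (T : 'M[R]_3) u v :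
  T *m T^T = 1%:M -> dot (u *m T) (v *m T) = dot u v.
Proof. by move=> TT; rewrite /dot trmx_mul mulmxA -(mulmxA u) TT mulmx1. Qed.

Lemma det_form_mul (T : 'M[R]_3) w u v :
  det_form (w *m T) (u *m T) (v *m T) = det_form w u v * \det T.
Proof. by rewrite /det_form -det_mulmx -!mul_col_mx. Qed.

(** The Gram matrix of pairwise orthogonal vectors is diagonal. *)
Lemma det_form_orthogonal w u v : dot u v = 0 -> dot v w = 0 -> dot u w = 0 ->
  det_form w u v ^+ 2 = dot u u * dot v v * dot w w.
Proof.
move=> uv vw uw.
have -> : det_form w u v ^+ 2 = dot u u * dot v v * dot w w
    + 2 * dot u v * dot v w * dot u w - dot u u * dot v w ^+ 2
    - dot v v * dot u w ^+ 2 - dot w w * dot u v ^+ 2.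
  by rewrite det_formE !dotE; ring.
by rewrite uv vw uw; ring.
Qed.

Section Plane.
Variables (U : {vspace 'rV[R]_3}) (w : 'rV[R]_3).
Hypotheses (dimU : \dim U = 2%N) (wU : w \notin U).

Lemma plane_normal : exists k, [/\ k != 0, forall u, u \in U -> dot u k = 0 &
  forall v, (forall u, u \in U -> v *m u^T = 0) -> exists a, v = a *: k].
Proof.
have [b [c [bU cU fr bc]]] := plane_basis dimU.
have k0 : cross b c != 0.
  move: fr; rewrite -[free _]negbK -(det_form_eq0 wU)//.
  apply: contraNneq => k0; rewrite (_ : det_form w b c = dot (cross b c) w).
    by rewrite k0 dotE !mxE; apply/eqP; ring.
  by rewrite det_formE dotE !mxE /=; ring.
exists (cross b c); split=> // [u /bc[x [y ->]]|v vU].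
  by rewrite dotE !mxE /=; ring.
have vb : dot v b = 0 by rewrite /dot vU// mxE.
have vc : dot v c = 0 by rewrite /dot vU// mxE.
have kk : dot (cross b c) (cross b c) != 0 by rewrite dotvv_eq0.
exists (dot v (cross b c) / dot (cross b c) (cross b c)).
apply: (scalerI kk); rewrite scalerA mulrCA divff// mulr1.
apply/eqP; rewrite -subr_eq0; apply/eqP.
(* The double cross product expansion of k x (v x k), for k = b x c. *)
transitivity (cross (cross b c) (dot v c *: b - dot v b *: c)).
  by apply: row3P; rewrite !dotE !mxE /=; ring.
by rewrite vb vc !scale0r subr0; apply: row3P; rewrite !mxE /=; ring.
Qed.

Lemma plane_half_turn : exists T : 'M[R]_3, plane_rotation U T /\
  forall u, u \in U -> u *m T = - u.
Proof.
have [k [k0 Uk kU]] := plane_normal.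
have N0 : dot k k != 0 by rewrite dotvv_eq0.
(* T fixes the normal line and reverses the vectors orthogonal to it. *)
pose T : 'M[R]_3 := (2 / dot k k) *: (k^T *m k) - 1%:M.
have TE v : v *m T = (2 / dot k k * dot v k) *: k - v.
  rewrite mulmxBr mulmx1 -scalemxAr mulmxA [v *m k^T]mx11_scalar.
  by rewrite mul_scalar_mx scalerA.
have kT : k *m T = k.
  by rewrite TE mulfVK// scaler_nat mulr2n addrK.
exists T; split; last by move=> u /Uk uk; rewrite TE uk mulr0 scale0r sub0r.
split=> [||v /kU[a ->]]; last by rewrite -scalemxAl kT.
- have TT : T^T = T.
    by rewrite /T linearB /= trmx1 linearZ /= trmx_mul trmxK.
  apply/row_matrixP => i; rewrite TT !rowE mulmxA mulmx1 [_ 0 i *m T]TE mulmxBl.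
  by rewrite -scalemxAl kT TE subKr.
- rewrite det3E !mxE !big_ord1 !mxE /=.
  by move: N0; rewrite dotE => N0; field.
Qed.

(** A rotation preserving the direction of one vector of the plane is the
    identity or the half-turn of the plane. As it fixes the normal vector, it
    preserves oriented areas in the plane as well as dot products; therefore
    v - a (v T) is orthogonal to u and spans no area with it, so it is 0. *)
Lemma rotation_eigenvector (T : 'M[R]_3) u a : plane_rotation U T ->
  u \in U -> u != 0 -> u *m T = a *: u ->
  forall v, v \in U -> v *m T = a *: v.
Proof.
move=> [TT dT fixT] uU u0 uT v vU.
have [k [k0 Uk kU]] := plane_normal.
have uu0 : dot u u != 0 by rewrite dotvv_eq0.
have a2 : a * a = 1.
  apply: (mulIf uu0); rewrite mul1r -[RHS](dot_isometry u u TT) uT.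
  by rewrite dotZl dotC dotZl mulrA.
have kT : k *m T = k.
  by apply: fixT => z zU; apply: dot_eq0; rewrite dotC Uk.
have dE : det_form k u (v - a *: (v *m T)) = 0.
  rewrite det_formBr det_formZr -[X in X - _]mulr1 -dT.
  by rewrite -det_form_mul kT uT det_formZl subrr.
have du : dot u (v - a *: (v *m T)) = 0.
  rewrite dotC dotDl -scaleNr dotZl mulNr -(dot_isometry v u TT) uT.
  by rewrite [dot (v *m T) (a *: u)]dotC dotZl [dot u _]dotC subrr.
have dk : dot (v - a *: (v *m T)) k = 0.
  by rewrite dotDl -scaleNr dotZl -{2}kT dot_isometry// Uk// mulr0 addr0.
have := det_form_orthogonal du dk (Uk _ uU).
rewrite dE expr0n /= => /esym/eqP; rewrite !mulf_eq0 (negPf uu0) !dotvv_eq0.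
rewrite (negPf k0) orbF /= subr_eq0 => /eqP vE.
by rewrite [in RHS]vE scalerA a2 scale1r.
Qed.

Section Polygons.
Variable n : nat.
Implicit Types P Q : 'M[R]_(n, 3).

Definition parallel_polygons P Q :=
  forall i, ~~ free [:: polygon_edge P i; polygon_edge Q i].

(** The ratio a may be negative; it is 1 for a translate of P and 0 for a
    single point. *)
Definition homothetic P Q :=
  exists (a : R) (t : 'rV[R]_3), forall i, row i Q = a *: row i P + t.

(** The edges of a similar parallel polygon force the rotation to be the
    identity or a half-turn. *)
Lemma similar_homothetic P Q i : in_plane_parallel_to U P ->
  parallel_polygons P Q -> polygon_edge P i != 0 ->
  related_by_similarity U P Q -> homothetic P Q.
Proof.
move=> PU PQ e0 [r [T [t [r0 rotT QE]]]].
have [r00|{}r0] := eqVneq r 0.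
  by exists 0, t => j; rewrite QE r00 !scale0r.
have eQ : polygon_edge Q i = r *: (polygon_edge P i *m T).
  by rewrite /polygon_edge !QE mulmxBl scalerBr opprD addrACA subrr addr0.
have := @parallel_combination _ 1 0 _ _ (PQ i).
rewrite scale1r scale0r addr0 => /(_ e0)[_ [m [_ mE]]].
have eT : polygon_edge P i *m T = (m / r) *: polygon_edge P i.
  by apply: (scalerI r0); rewrite -eQ mE scalerA mulrC mulfVK.
exists m, (r *: (row i P *m T) + t - m *: row i P) => j.
have := rotation_eigenvector rotT (PU _ _) e0 eT (PU j i).
rewrite mulmxBl => /(congr1 ( *:%R r)); rewrite scalerBr scalerA mulrC mulfVK//.
move=> e; rewrite QE -[r *: (row j P *m T)](subrK (r *: (row i P *m T))) e.
by rewrite scalerBr addrCA addrC !addrA addrAC.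
Qed.

(** A homothety with negative ratio is one with positive ratio followed by a
    half-turn. *)
Lemma homothetic_similar P Q (i : 'I_n) : in_plane_parallel_to U P ->
  homothetic P Q -> related_by_similarity U P Q.
Proof.
move=> PU [a [t QE]]; have [a0|a0] := leP 0 a.
  exists a, 1%:M, t; split=> // [|j]; last by rewrite mulmx1.
  by split; rewrite ?trmx1 ?mulmx1 ?det1// => v _; rewrite mulmx1.
have [T [rotT TU]] := plane_half_turn.
exists (- a), T, (t + a *: (row i P + row i P *m T)).
split=> // [|j]; first by rewrite oppr_ge0 ltW.
have := TU _ (PU j i); rewrite mulmxBl => /eqP; rewrite subr_eq => /eqP ->.
rewrite QE; apply: row3P; rewrite !mxE; ring.
Qed.

End Polygons.
End Plane.
End Similarity.

(** * The area form and the principal curvatures *)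

Section Area.
Variables (R : realType) (n : nat) (w : 'rV[R]_3).
Implicit Types (P Q : 'M[R]_(n, 3)).

Lemma rowD_scale a b P Q i :
  row i (a *: P + b *: Q) = a *: row i P + b *: row i Q.
Proof. by apply/rowP => j; rewrite !mxE. Qed.

Lemma polygon_edgeD_scale a b P Q i : polygon_edge (a *: P + b *: Q) i =
  a *: polygon_edge P i + b *: polygon_edge Q i.
Proof. by rewrite /polygon_edge !rowD_scale !scalerBr opprD addrACA. Qed.

Lemma sum_ordS (V : nmodType) (F : 'I_n -> V) : \sum_i F (ordS i) = \sum_i F i.
Proof. by rewrite [RHS](reindex_inj (@ordS_inj n)). Qed.

Lemma area_lincomb a b P Q : area w (a *: P + b *: Q) =
  a ^+ 2 * area w P + 2 * a * b * mixed_area w P Q + b ^+ 2 * area w Q.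
Proof.
pose B := \sum_i (det_form w (row i P) (row (ordS i) Q) +
                  det_form w (row i Q) (row (ordS i) P)).
have E c d : area w (c *: P + d *: Q) =
    c ^+ 2 * area w P + c * d * (2^-1 * B) + d ^+ 2 * area w Q.
  rewrite /area (eq_bigr (fun i =>
    c ^+ 2 * det_form w (row i P) (row (ordS i) P) +
    (c * d * (det_form w (row i P) (row (ordS i) Q) +
              det_form w (row i Q) (row (ordS i) P)) +
     d ^+ 2 * det_form w (row i Q) (row (ordS i) Q)))); last first.
    move=> i _; rewrite !rowD_scale !det_formDl !det_formDr.
    by rewrite !det_formZl !det_formZr; ring.
  by rewrite !big_split /= -!mulr_sumr -/B; ring.
rewrite E; have := E 1 1; rewrite !scale1r /mixed_area => ->.
by field.
Qed.

(** The terms that are linear in the translation vector t cancel when summed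
    over a closed polygon. *)
Lemma area_homothetic P Q a t : (forall i, row i Q = a *: row i P + t) ->
  area w Q = a ^+ 2 * area w P.
Proof.
move=> QE; rewrite /area mulrCA; congr (_ * _).
rewrite (eq_bigr (fun i => a ^+ 2 * det_form w (row i P) (row (ordS i) P) +
   (a * det_form w t (row (ordS i) P) - a * det_form w t (row i P)))).
  rewrite big_split /= sumrB (sum_ordS (fun i => a * det_form w t (row i P))).
  by rewrite subrr addr0 mulr_sumr.
move=> i _; rewrite !QE !det_formDl !det_formDr !det_formZl !det_formZr.
by rewrite det_formvv (det_formC w (row i P) t); ring.
Qed.

Lemma area_translate P t : area w P =
  2^-1 * \sum_i det_form w (row i P - t) (row (ordS i) P - t).
Proof.
have -> : area w P = area w (P - \matrix_i t).
  rewrite [RHS](@area_homothetic P _ 1 (- t)) ?expr1n ?mul1r// => i.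
  by apply/rowP => j; rewrite !mxE mul1r.
rewrite /area; congr (_ * _); apply: eq_bigr => i _.
by congr det_form; apply/rowP => j; rewrite !mxE.
Qed.

(** A quarter of the discriminant of the quadratic form x |-> area (x P + Q). *)
Definition area_disc P Q := mixed_area w P Q ^+ 2 - area w P * area w Q.

(** Completing the square. *)
Lemma area_disc_lincomb P Q a b :
  area w P * area w (a *: P + b *: Q) =
  (a * area w P + b * mixed_area w P Q) ^+ 2 - b ^+ 2 * area_disc P Q.
Proof. by rewrite area_lincomb /area_disc; ring. Qed.

Lemma homothetic_area_disc P Q : homothetic P Q -> area_disc P Q = 0.
Proof.
move=> [a [t QE]]; rewrite /area_disc /mixed_area (area_homothetic QE).
rewrite (@area_homothetic P (P + Q) (1 + a) t); first by field.
by move=> i; apply/rowP => j; have /rowP/(_ j) := QE i; rewrite !mxE => ->; ring.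
Qed.

Section Curvatures.
Variables P Q : 'M[R]_(n, 3).
Hypothesis areaP : area w P != 0.

Lemma principal_curvaturesP k1 k2 : are_principal_curvatures w P Q k1 k2 <->
  k1 + k2 = 2 * mean_curvature w P Q /\ k1 * k2 = gauss_curvature w P Q.
Proof.
rewrite /are_principal_curvatures /curvature_poly.
split=> [E|[<- <-]]; last first.
  by rewrite -mul_polyC polyCM polyCD; ring.
have E0 := congr1 (horner^~ 0) E; have E1 := congr1 (horner^~ 1) E.
move: E0 E1; rewrite !hornerE /= => E0 E1; split; lra.
Qed.

Lemma area_disc_curvatures : area_disc P Q =
  area w P ^+ 2 * (mean_curvature w P Q ^+ 2 - gauss_curvature w P Q).
Proof. by rewrite /area_disc /mean_curvature /gauss_curvature; field. Qed.

Lemma principal_curvatures_disc k1 k2 : are_principal_curvatures w P Q k1 k2 ->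
  4 * area_disc P Q = area w P ^+ 2 * (k1 - k2) ^+ 2.
Proof.
by rewrite area_disc_curvatures => /principal_curvaturesP[s p]; rewrite -p; nra.
Qed.

Lemma principal_curvatures_existP :
  principal_curvatures_exist w P Q <-> 0 <= area_disc P Q.
Proof.
have A0 : 0 < area w P ^+ 2 by rewrite exprn_even_gt0.
split=> [[k1 [k2 /principal_curvatures_disc E]]|].
  have : 0 <= area w P ^+ 2 * (k1 - k2) ^+ 2 by rewrite mulr_ge0 ?sqr_ge0.
  by rewrite -E; lra.
rewrite area_disc_curvatures pmulr_rge0// => D0.
set H := mean_curvature w P Q in D0; set K := gauss_curvature w P Q in D0.
exists (H + Num.sqrt (H ^+ 2 - K)), (H - Num.sqrt (H ^+ 2 - K)).
apply/principal_curvaturesP; rewrite -/H -/K; split; first by ring.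
by rewrite mulrC -subr_sqr sqr_sqrtr// opprB addrC subrK.
Qed.

Lemma double_principal_curvature :
  (exists k, are_principal_curvatures w P Q k k) <-> area_disc P Q = 0.
Proof.
split=> [[k /principal_curvatures_disc]|D0].
  by rewrite subrr expr0n mulr0; lra.
have [|k1 [k2 k12]] := principal_curvatures_existP.2; first by rewrite D0.
exists k1; have := principal_curvatures_disc k12.
rewrite D0 mulr0 => /esym/eqP; rewrite mulf_eq0 !expf_eq0 /= (negPf areaP) /=.
by rewrite subr_eq0 => /eqP k12E; rewrite -k12E in k12.
Qed.

(** This turns assertions about the two principal curvatures into the sign of
    the discriminant and the case in which it vanishes. *)
Lemma principal_curvatures_similar (U : {vspace 'rV[R]_3}) :
  0 <= area_disc P Q ->
  (area_disc P Q = 0 <-> related_by_similarity U P Q) ->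
  exists k1 k2, are_principal_curvatures w P Q k1 k2 /\
    (k1 = k2 <-> related_by_similarity U P Q).
Proof.
move=> /principal_curvatures_existP[k1 [k2 k12]] D0.
exists k1, k2; split=> //; rewrite -D0.
have E := principal_curvatures_disc k12; split=> [k12E|d0].
  by move: E; rewrite k12E subrr expr0n mulr0; lra.
move: E; rewrite d0 mulr0 => /esym/eqP.
rewrite mulf_eq0 !expf_eq0 /= (negPf areaP) /= subr_eq0.
by move/eqP.
Qed.

End Curvatures.
End Area.

(** * Quadrilaterals with given edge directions *)

Section CyclicIndex.
Variable n : nat.
Implicit Types i j : 'I_n.

Lemma ordS_ind (p : 'I_n -> Prop) i : p i -> (forall j, p j -> p (ordS j)) ->
  forall j, p j.
Proof.
move=> p0 pS; have n0 : (0 < n)%N by case: i {p0} => i /(leq_trans _) ->.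
have E k : p (iter k (@ordS n) i) by elim: k => //= k /pS.
have vE k : val (iter k (@ordS n) i) = ((i + k) %% n)%N.
  elim: k => [|k /= ->]; first by rewrite addn0 modn_small.
  by rewrite -addn1 modnDml addn1 addnS.
move=> j; have -> : j = iter (j + (n - i)) (@ordS n) i; last exact: E.
apply/val_inj; rewrite vE addnCA subnKC ?modnDr ?modn_small//.
exact: ltnW.
Qed.

End CyclicIndex.

Section QuadIndex.
Implicit Types i j : 'I_4.
Local Notation S := (@ordS 4).

Lemma ordS4 i : S (S (S (S i))) = i.
Proof. by apply/val_inj; case: i => -[|[|[|[|]]]]. Qed.

Lemma ordS4_neq i : [/\ (S i == i) = false, (S (S i) == i) = false &
  (S (S (S i)) == i) = false].
Proof. by case: i => -[|[|[|[|]]]]. Qed.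

Lemma ordS4P i (p : 'I_4 -> Prop) :
  p i -> p (S i) -> p (S (S i)) -> p (S (S (S i))) -> forall j, p j.
Proof.
move=> p0 p1 p2 p3 j.
have : [|| j == i, j == S i, j == S (S i) | j == S (S (S i))].
  by case: i {p0 p1 p2 p3} j => -[|[|[|[|//]]]] i [[|[|[|[|//]]]] j].
by case/or4P => /eqP->.
Qed.

Lemma big_ordS4 (V : Type) (e : V) (op : Monoid.com_law e) (F : 'I_4 -> V) i :
  \big[op/e]_j F j = op (op (op (F i) (F (S i))) (F (S (S i)))) (F (S (S (S i)))).
Proof.
have [n1 n2 n3] := ordS4_neq i.
rewrite (bigD1 i)//= (bigD1 (S i)) ?n1//= (bigD1 (S (S i)))//=; last first.
  by rewrite n2 (inj_eq (@ordS_inj 4)) n1.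
rewrite (bigD1 (S (S (S i))))/=; last first.
  by rewrite n3 !(inj_eq (@ordS_inj 4)) n2 n1.
rewrite big1 ?Monoid.mulm1 ?Monoid.mulmA// => j.
by elim/(@ordS4P i): j; rewrite eqxx ?andbF.
Qed.

End QuadIndex.

Section Quadrilateral.
Variables (R : realType) (w : 'rV[R]_3).
Implicit Types (P Q N : 'M[R]_(4, 3)) (i : 'I_4).
Local Notation S := (@ordS 4).

(** Twice the oriented area of the triangle that the edges i and i + 1 cut off
    at their common vertex. *)
Definition turn n (P : 'M[R]_(n, 3)) (i : 'I_n) : R :=
  det_form w (polygon_edge P i) (polygon_edge P (ordS i)).

Lemma sum_polygon_edge n (P : 'M[R]_(n, 3)) : \sum_(i < n) polygon_edge P i = 0.
Proof. by rewrite sumrB (sum_ordS (fun j : 'I_n => row j P)) subrr. Qed.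

Lemma quad_last_edge P i : polygon_edge P (S (S (S i))) =
  - (polygon_edge P i + polygon_edge P (S i) + polygon_edge P (S (S i))).
Proof.
have /eqP := sum_polygon_edge P; rewrite (big_ordS4 _ _ i) /= addr_eq0 => /eqP ->.
by rewrite opprK.
Qed.

Lemma quad_area P i : 2 * area w P = turn P i + turn P (S (S i)).
Proof.
rewrite /area mulVKf ?pnatr_eq0// (big_ordS4 _ _ i) /= /turn /polygon_edge !ordS4.
rewrite !det_formBl !det_formBr !det_formvv.
rewrite (det_formC w (row (S (S i)) P) (row i P)).
ring.
Qed.

(** The two diagonals decompose the area in two ways. *)
Lemma quad_turnD P i :
  turn P i + turn P (S (S i)) = turn P (S i) + turn P (S (S (S i))).
Proof. by rewrite -(quad_area P i) -(quad_area P (S i)). Qed.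

Section InPlane.
Variable U : {vspace 'rV[R]_3}.
Hypothesis dimU : \dim U = 2%N.

Lemma polygon_edge_plane n (P : 'M[R]_(n, 3)) (i : 'I_n) :
  in_plane_parallel_to U P -> polygon_edge P i \in U.
Proof. by move=> PU; exact: PU. Qed.

Lemma quad_plucker N i : in_plane_parallel_to U N ->
  turn N i * turn N (S (S i)) = turn N (S i) * turn N (S (S (S i))) +
    det_form w (polygon_edge N i) (polygon_edge N (S (S i))) *
    det_form w (polygon_edge N (S i)) (polygon_edge N (S (S (S i)))).
Proof.
move=> NU; have eU j := polygon_edge_plane j NU.
rewrite /turn ordS4 (det_form_plucker dimU _ _ (eU i) (eU (S i)) (eU (S (S i)))).
rewrite (det_formC w (polygon_edge N (S (S i))) (polygon_edge N (S i))).
rewrite (det_formC w (polygon_edge N i) (polygon_edge N (S (S (S i))))).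
by rewrite mulrNN.
Qed.

(** As P closes up, two of the factors l are determined by the other two, and
    the area becomes a binary quadratic form in the latter. *)
Lemma quad_area_edges N P (l : 'I_4 -> R) i : in_plane_parallel_to U N ->
  (forall j, polygon_edge P j = l j *: polygon_edge N j) ->
  let d := fun j => det_form w (polygon_edge N j) (polygon_edge N (S (S j))) in
  [/\ turn N i * l i = l (S (S i)) * turn N (S i) + l (S (S (S i))) * d (S i),
    turn N i * l (S i) =
      l (S (S (S i))) * turn N (S (S (S i))) - l (S (S i)) * d i &
    turn N i * (2 * area w P) =
      2 * l (S (S i)) * l (S (S (S i))) * turn N (S i) * turn N (S (S (S i)))
      - l (S (S i)) ^+ 2 * turn N (S i) * d i
      + l (S (S (S i))) ^+ 2 * turn N (S (S (S i))) * d (S i)].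
Proof.
move=> NU PN d.
have clP : \sum_j l j *: polygon_edge N j = 0.
  by rewrite -[RHS](sum_polygon_edge P); apply: eq_bigr => j _; rewrite PN.
have cl v : \sum_j l j * det_form w v (polygon_edge N j) = 0.
  rewrite -[RHS](det_form0r w v) -clP det_form_sumr.
  by apply: eq_bigr => j _; rewrite det_formZr.
have pl := quad_plucker i NU; rewrite -!/(d _) in pl.
have E1 := cl (polygon_edge N (S i)); have E0 := cl (polygon_edge N i).
rewrite !(big_ordS4 _ _ i) /= in E1 E0.
rewrite !det_formvv -?/(turn _ _) -?/(d _) in E1 E0.
rewrite (det_formC w _ (polygon_edge N i)) -/(turn _ _) in E1.
rewrite (det_formC w (polygon_edge N i) (polygon_edge N (S (S (S i))))) in E0.
have t3 : det_form w (polygon_edge N (S (S (S i)))) (polygon_edge N i) =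
    turn N (S (S (S i))) by rewrite /turn ordS4.
rewrite t3 in E0.
have e0 : turn N i * l i =
    l (S (S i)) * turn N (S i) + l (S (S (S i))) * d (S i) by lra.
have e1 : turn N i * l (S i) =
    l (S (S (S i))) * turn N (S (S (S i))) - l (S (S i)) * d i by lra.
split=> //.
rewrite (quad_area _ i) /turn !PN !det_formZl !det_formZr -!/(turn _ _).
transitivity ((turn N i * l i) * (turn N i * l (S i)) +
   l (S (S i)) * l (S (S (S i))) * (turn N i * turn N (S (S i)))); first by ring.
by rewrite e0 e1 pl; ring.
Qed.

(** By the Pluecker relation, the discriminant of this binary form is
    essentially the product of the turns of N: this is why the quadrilaterals
    parallel to N have real principal curvatures or not according to its sign.
    The factor in l and m measures the linear independence of P and Q. *)
Lemma quad_area_disc N P Q (l m : 'I_4 -> R) i : in_plane_parallel_to U N ->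
  (forall j, polygon_edge P j = l j *: polygon_edge N j) ->
  (forall j, polygon_edge Q j = m j *: polygon_edge N j) ->
  turn N i != 0 ->
  4 * turn N i ^+ 2 * area_disc w P Q =
  \prod_j turn N j *
    (l (S (S i)) * m (S (S (S i))) - l (S (S (S i))) * m (S (S i))) ^+ 2.
Proof.
move=> NU PN QN t0.
have [_ _ EP] := quad_area_edges i NU PN.
have [_ _ EQ] := quad_area_edges i NU QN.
have PQN j : polygon_edge (P + Q) j = (l j + m j) *: polygon_edge N j.
  have := polygon_edgeD_scale 1 1 P Q j; rewrite !scale1r => ->.
  by rewrite PN QN scalerDl.
have [_ _ EPQ] := quad_area_edges i NU PQN.
rewrite (big_ordS4 _ _ i) /=.
rewrite (_ : turn N i * _ * _ * _ = (turn N i * turn N (S (S i))) *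
    (turn N (S i) * turn N (S (S (S i))))); last by ring.
have pl := quad_plucker i NU.
rewrite pl /area_disc /mixed_area.
set A := area w P in EP *; set B := area w Q in EQ *.
set AB := area w (P + Q) in EPQ *.
transitivity ((2^-1 * (turn N i * (2 * AB) - turn N i * (2 * A)
    - turn N i * (2 * B))) ^+ 2 - (turn N i * (2 * A)) * (turn N i * (2 * B))).
  by field.
by rewrite EPQ EP EQ; field.
Qed.

End InPlane.
End Quadrilateral.

(** * Proportional polygons and the discriminant of quadrilaterals *)

Section Homothety.
Variables (R : realType) (n : nat).
Implicit Types P Q : 'M[R]_(n, 3).

Lemma polygon_edge0_const P (i : 'I_n) : (forall j, polygon_edge P j = 0) ->
  forall j, row j P = row i P.
Proof.
move=> P0; apply: (@ordS_ind _ _ i) => // j <-.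
by apply/eqP; rewrite -subr_eq0; apply/eqP/P0.
Qed.

Lemma edges_homothetic P Q (i : 'I_n) (c : R) :
  (forall j, polygon_edge Q j = c *: polygon_edge P j) -> homothetic P Q.
Proof.
move=> PQ; exists c, (row i Q - c *: row i P) => j.
have Y0 k : polygon_edge (1 *: Q + (- c) *: P) k = 0.
  by rewrite polygon_edgeD_scale PQ scale1r scaleNr subrr.
have := polygon_edge0_const i Y0 j.
by rewrite !rowD_scale !scale1r !scaleNr => <-; rewrite addrC subrK.
Qed.

Lemma lincomb_in_plane (U : {vspace 'rV[R]_3}) P Q a b :
  in_plane_parallel_to U P -> in_plane_parallel_to U Q ->
  in_plane_parallel_to U (a *: P + b *: Q).
Proof.
move=> PU QU i j; rewrite !rowD_scale opprD addrACA -!scalerBr.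
by rewrite memvD// memvZ// ?PU ?QU.
Qed.

Lemma parallel_edges P Q a b : parallel_polygons P Q ->
  (forall i, polygon_edge (a *: P + b *: Q) i != 0) ->
  exists l m : 'I_n -> R,
    (forall i, polygon_edge P i = l i *: polygon_edge (a *: P + b *: Q) i) /\
    (forall i, polygon_edge Q i = m i *: polygon_edge (a *: P + b *: Q) i).
Proof.
move=> PQ N0.
have /choice[l lE] : forall i, exists x,
    polygon_edge P i = x *: polygon_edge (a *: P + b *: Q) i.
  move=> i; have := N0 i; rewrite polygon_edgeD_scale.
  by case/(parallel_combination (PQ i)) => x [_ [xE _]]; exists x.
have /choice[m mE] : forall i, exists x,
    polygon_edge Q i = x *: polygon_edge (a *: P + b *: Q) i.
  move=> i; have := N0 i; rewrite polygon_edgeD_scale.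
  by case/(parallel_combination (PQ i)) => _ [x [_ xE]]; exists x.
by exists l, m.
Qed.

End Homothety.

Section QuadDiscriminant.
Variables (R : realType) (w : 'rV[R]_3) (U : {vspace 'rV[R]_3}).
Hypothesis dimU : \dim U = 2%N.
Variables (P Q N : 'M[R]_(4, 3)) (a b : R).
Hypotheses (NE : N = a *: P + b *: Q) (NU : in_plane_parallel_to U N)
  (PQ : parallel_polygons P Q) (turn0 : forall i, turn w N i != 0)
  (areaP : area w P != 0).
Local Notation S := (@ordS 4).
Local Notation i0 := (@ord0 3).

(** The quadrilaterals with edges parallel to those of N form a plane, up to
    translations. Either P and Q span it, and the sign of the discriminant is
    that of its area form, or they are proportional. *)
Lemma quad_disc_dichotomy : homothetic P Q \/
  exists2 k : R, 0 < k & area_disc w P Q = k * \prod_j turn w N j.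
Proof.
have N0 i : polygon_edge N i != 0.
  apply: contraNneq (turn0 i) => e0.
  by rewrite /turn e0 det_form0l.
have [l [m []]] : exists l m : 'I_4 -> R,
    (forall i, polygon_edge P i = l i *: polygon_edge N i) /\
    (forall i, polygon_edge Q i = m i *: polygon_edge N i).
  by move: N0; rewrite NE; exact: parallel_edges.
move=> PN QN; have t0 := turn0 i0.
have D := quad_area_disc dimU NU PN QN t0.
have [l0 l1 lA] := quad_area_edges w dimU i0 NU PN.
have [m0 m1 _] := quad_area_edges w dimU i0 NU QN.
set x := l (S (S i0)) in D l0 l1 lA; set y := l (S (S (S i0))) in D l0 l1 lA.
set x' := m (S (S i0)) in D m0 m1; set y' := m (S (S (S i0))) in D m0 m1.
(* The last two edges are coordinates on this plane; the expression below is
   the determinant of those of P and Q. *)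
have [K0|K0] := eqVneq (x * y' - y * x') 0; last first.
  right; exists ((x * y' - y * x') ^+ 2 / (4 * turn w N i0 ^+ 2)).
    by apply: divr_gt0; [|apply: mulr_gt0 => //]; rewrite exprn_even_gt0.
  have k0 : 4 * turn w N i0 ^+ 2 != 0.
    by rewrite mulf_neq0 ?expf_neq0// pnatr_eq0.
  by apply: (mulfI k0); rewrite D; field.
left.
have xy : (x != 0) || (y != 0).
  apply: contra_neqT areaP; rewrite negb_or !negbK => /andP[/eqP x0 /eqP y0].
  have /eqP : turn w N i0 * (2 * area w P) = 0 by rewrite lA x0 y0; ring.
  by rewrite mulf_eq0 (negPf t0) mulf_eq0 pnatr_eq0 => /eqP.
have [c [xE yE]] : exists c, x' = c * x /\ y' = c * y.
  case/orP: xy => z0; [exists (x' / x)|exists (y' / y)];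
    by rewrite mulfVK//; split=> //; rewrite mulrAC;
      apply: (canRL (mulfK z0)); lra.
apply: (@edges_homothetic _ _ _ _ i0 c) => j.
suff mE : m j = c * l j by rewrite QN PN mE scalerA.
elim/(@ordS4P i0): j => //; apply: (mulfI t0).
- by rewrite m0 mulrCA l0 xE yE; ring.
- by rewrite m1 mulrCA l1 xE yE; ring.
Qed.

Lemma quad_disc0_homothetic : area_disc w P Q = 0 -> homothetic P Q.
Proof.
move=> D0; have [//|[k k0]] := quad_disc_dichotomy.
rewrite D0 => /esym/eqP; rewrite mulf_eq0 gt_eqF//= => /prodf_eq0[i _].
by rewrite (negPf (turn0 i)).
Qed.

Lemma quad_disc_ge0 : ~ homothetic P Q ->
  0 <= area_disc w P Q <-> 0 < \prod_j turn w N j.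
Proof.
move=> nh; have [//|[k k0 ->]] := quad_disc_dichotomy.
rewrite pmulr_rge0// le_eqVlt eq_sym; split=> [|->]; last by rewrite orbT.
case/orP => // /prodf_eq0[i _].
by rewrite (negPf (turn0 i)).
Qed.

End QuadDiscriminant.

(** * Quadrilaterals with vertices in convex position *)

Section HullBoundary.
Variables (R : realType) (w : 'rV[R]_3).

Lemma det_form_continuous u : continuous (fun x => det_form w u x).
Proof.
have -> : (fun x => det_form w u x) = (fun x : 'rV[R]_3 =>
    x 0 ord3_0 * (u 0 ord3_2 * w 0 ord3_1 - u 0 ord3_1 * w 0 ord3_2) +
    x 0 ord3_1 * (u 0 ord3_0 * w 0 ord3_2 - u 0 ord3_2 * w 0 ord3_0) +
    x 0 ord3_2 * (u 0 ord3_1 * w 0 ord3_0 - u 0 ord3_0 * w 0 ord3_1)).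
  by apply/funext => x; rewrite det_formE; ring.
have cM (j : 'I_3) (a : R) (x : 'rV[R]_3) :
    (fun y : 'rV[R]_3 => y 0 j * a) @ x --> x 0 j * a.
  by apply: (@cvgMr_tmp R _ (nbhs x)); exact: coord_continuous.
by move=> x; exact: cvgD (cvgD (cM _ _ _) (cM _ _ _)) (cM _ _ _).
Qed.

Lemma det_form_near (u p : 'rV[R]_3) (e : R) : 0 < e ->
  \forall x \near p, `|det_form w u (x - p)| < e.
Proof.
move=> e0.
have /cvgrPdist_lt/(_ _ e0) := @det_form_continuous u p.
by apply: filterS => x; rewrite det_formBr distrC.
Qed.

Section Hull.
Variables (n : nat) (P : 'M[R]_(n, 3)) (U : {vspace 'rV[R]_3}).

Lemma hull_det_form_ge0 u p : (forall j, 0 <= det_form w u (row j P - p)) ->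
  forall x, hull P x -> 0 <= det_form w u (x - p).
Proof.
move=> Pu _ [c [c0 c1 ->]].
have -> : c *m P - p = \sum_j c ord0 j *: (row j P - p).
  rewrite mulmx_sum_row; under [RHS]eq_bigr do rewrite scalerBr.
  by rewrite sumrB -scaler_suml c1 scale1r.
rewrite det_form_sumr sumr_ge0// => j _.
by rewrite det_formZr mulr_ge0.
Qed.

(** Moving the vertex away from the vertex k leads to the other side of the
    supporting line in direction u. *)
Lemma support_hull_boundary i u k : row k P - row i P \in U ->
  (forall j, 0 <= det_form w u (row j P - row i P)) ->
  0 < det_form w u (row k P - row i P) ->
  ~ (\forall x \near row i P, x - row i P \in U -> hull P x).
Proof.
move=> kU Pu uk.
set v := row k P - row i P in kU uk.
have cv : (fun t : R => row i P - t *: v) @ (0 : R) --> row i P.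
  rewrite -[X in _ --> X]subr0 -(scale0r v).
  by apply: cvgB; [exact: cvg_cst | exact: cvgZr_tmp].
move=> /cv /nbhs_norm0P[e /= e0 /(_ (e / 2))] /=.
rewrite ger0_norm ?divr_ge0 1?ltW// ltr_pdivrMr// ltr_pMr// ltr1n.
rewrite addrAC subrr sub0r memvN memvZ// => /(_ isT isT) /hull_det_form_ge0.
move=> /(_ _ _ Pu); rewrite addrAC subrr sub0r det_formNr det_formZr oppr_ge0.
by rewrite leNgt mulr_gt0// divr_gt0.
Qed.

End Hull.
End HullBoundary.

Lemma odd_one_out_sign (R : realDomainType) (x y z t : R) : x * y * z * t < 0 ->
  [\/ [/\ x * y < 0, x * z < 0 & x * t < 0],
      [/\ y * x < 0, y * z < 0 & y * t < 0],
      [/\ z * x < 0, z * y < 0 & z * t < 0] |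
      [/\ t * x < 0, t * y < 0 & t * z < 0]].
Proof.
move=> neg; have : x * y * z * t != 0 by rewrite lt_eqF.
rewrite !mulf_eq0 !negb_or !neq_lt => /andP[/andP[/andP[]]].
have N11 : (1 == -1 :> R) = false by apply/eqP; lra.
rewrite -!sgr_cp0 !sgrM in neg *.
move=> /orP[]/eqP xE /orP[]/eqP yE /orP[]/eqP zE /orP[]/eqP tE;
  move: neg;
  rewrite xE yE zE tE !(mul1r, mulr1, mulN1r, opprK, N11, eqxx) => // _;
  by [constructor 1 | constructor 2 | constructor 3 | constructor 4].
Qed.

Lemma cyclic_neighbours_sign (R : realDomainType) (x y z t : R) : x + z = y + t ->
  0 < x * y * z * t ->
  [\/ 0 < x /\ 0 < t, x < 0 /\ t < 0, 0 < t /\ 0 < z | t < 0 /\ z < 0].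
Proof.
move=> e pos.
have : x * y * z * t != 0 by rewrite gt_eqF.
rewrite !mulf_eq0 !negb_or !neq_lt.
move=> /andP[/andP[/andP[/orP[]x0 y0]]] /orP[]z0 /orP[]t0;
  try by [constructor 1 | constructor 2 | constructor 3 | constructor 4].
- have y1 : y < 0 by lra.
  have : 0 < x * y by rewrite nmulr_rgt0.
  have : z * t < 0 by rewrite nmulr_rlt0.
  by nra.
- have y1 : 0 < y by lra.
  have : 0 < x * y by rewrite mulr_gt0.
  have : z * t < 0 by rewrite pmulr_rlt0.
  by nra.
Qed.

Section QuadConvexPosition.
Variables (R : realType) (w : 'rV[R]_3) (U : {vspace 'rV[R]_3}).
Hypothesis dimU : \dim U = 2%N.
Variable P : 'M[R]_(4, 3).
Hypotheses (PU : in_plane_parallel_to U P) (turn0 : forall i, turn w P i != 0).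
Local Notation S := (@ordS 4).
Local Notation i0 := (@ord0 3).

(** The coefficients of the affine dependence of the four vertices: up to the
    sign (-1)^j, twice the area of the triangle omitting the j-th vertex. *)
Definition affine_coef (j : 'I_4) : R := (-1) ^+ j * turn w P (S j).

Lemma affine_coef_prod : \prod_j affine_coef j = \prod_j turn w P j.
Proof.
rewrite /affine_coef big_split /= (reindex_inj (@ordS_inj 4)) /=.
rewrite [X in _ * X](reindex_inj (@ord_pred_inj 4)) /=.
rewrite (big_ordS4 _ _ i0) /= expr0.
under eq_bigr do rewrite ord_predK.
by ring.
Qed.

Lemma affine_coef_sum : \sum_j affine_coef j = 0.
Proof.
have := quad_turnD w P i0; rewrite (big_ordS4 _ _ i0) /affine_coef /= ordS4.
by rewrite !exprS expr0 => e; lra.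
Qed.

Lemma affine_coef_row : \sum_j affine_coef j *: row j P = 0.
Proof.
have eU j := polygon_edge_plane j PU.
have := det_form_cramer dimU w (eU (S i0)) (eU (S (S i0))) (eU (S (S (S i0)))).
have D13 : det_form w (polygon_edge P (S i0)) (polygon_edge P (S (S (S i0)))) =
    turn w P i0 - turn w P (S i0).
  rewrite (quad_last_edge P i0) det_formNr 2!det_formDr det_formvv.
  by rewrite (det_formC w _ (polygon_edge P i0)) /turn; ring.
rewrite D13 (det_formC w (polygon_edge P (S (S (S i0)))) _).
rewrite -!/(turn w P _) => E.
have T := quad_turnD w P i0.
pose z := turn w P (S i0) *: polygon_edge P (S (S (S i0))).
apply/eqP; rewrite -subr_eq0 -[X in _ - X](subrr z) {2}/z E /z.
apply/eqP; rewrite (big_ordS4 _ _ i0) /affine_coef /= ordS4 /polygon_edge ordS4.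
rewrite !exprS expr0.
have -> : turn w P (S (S (S i0))) =
  turn w P i0 + turn w P (S (S i0)) - turn w P (S i0) by lra.
apply: row3P; rewrite !mxE; ring.
Qed.

(** One coefficient of the affine dependence differs in sign from the three
    others. Solving for its vertex yields a convex combination. *)
Lemma quad_inner_vertex : \prod_j turn w P j < 0 -> exists i (c : 'I_4 -> R),
  [/\ c i = 0, forall j, j != i -> 0 < c j, \sum_j c j = 1 &
      row i P = \sum_j c j *: row j P].
Proof.
rewrite -affine_coef_prod => neg.
have [i iP] : exists i, forall j, j != i -> affine_coef i * affine_coef j < 0.
  move: neg; rewrite (big_ordS4 _ _ i0) /= => /odd_one_out_sign.
  by case=> -[? ? ?]; [exists i0|exists (S i0)|exists (S (S i0))|
    exists (S (S (S i0)))]; apply: (@ordS4P i0) => //; rewrite eqxx.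
have ai0 : affine_coef i != 0.
  have := iP (S i); have [-> _ _] := ordS4_neq i => /(_ isT).
  by apply: contraTneq => ->; rewrite mul0r ltxx.
exists i, (fun j => if j == i then 0 else - (affine_coef j / affine_coef i)).
rewrite eqxx; split=> //.
- move=> j ji; rewrite (negPf ji) oppr_gt0.
  rewrite -(pmulr_llt0 _ (_ : 0 < affine_coef i ^+ 2)) ?exprn_even_gt0//.
  by rewrite expr2 mulrA mulfVK// mulrC iP.
- rewrite (bigD1 i)//= eqxx add0r.
  rewrite (eq_bigr (fun j => - (affine_coef j / affine_coef i))); last first.
    by move=> j /negPf ->.
  rewrite sumrN -mulr_suml; have := affine_coef_sum.
  rewrite (bigD1 i)//= => /eqP; rewrite addrC addr_eq0 => /eqP->.
  by rewrite mulNr opprK divff.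
- rewrite (bigD1 i)//= eqxx scale0r add0r.
  rewrite (eq_bigr (fun j => - (affine_coef i)^-1 *: (affine_coef j *: row j P))).
    rewrite -scaler_sumr; have := affine_coef_row.
    rewrite (bigD1 i)//= => /eqP; rewrite addrC addr_eq0 => /eqP->.
    by rewrite scaleNr scalerN opprK scalerK.
  by move=> j /negPf ->; rewrite scalerA mulNr mulrC.
Qed.

(** The coefficients of a convex combination with positive coefficients stay
    positive if the point moves a little in the plane. *)
Lemma inner_hull_neighbourhood i (c : 'I_4 -> R) : c i = 0 ->
  (forall j, j != i -> 0 < c j) -> \sum_j c j = 1 ->
  row i P = \sum_j c j *: row j P ->
  \forall x \near row i P, x - row i P \in U -> hull P x.
Proof.
move=> ci cpos c1 iE; set p := row i P.
have [n1 n2 n3] := ordS4_neq i.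
have [e e0 ce] : exists2 e, 0 < e & forall j, j != i -> 2 * e <= c j.
  exists (Num.min (c (S i)) (Num.min (c (S (S i))) (c (S (S (S i))))) / 2).
    by rewrite divr_gt0// !lt_min !cpos ?n1 ?n2 ?n3.
  rewrite mulrC divfK ?pnatr_eq0//.
  by apply: (@ordS4P i); rewrite ?eqxx// !ge_min lexx ?orbT.
pose u := polygon_edge P (S i); pose v := polygon_edge P (S (S i)).
have uU : u \in U by exact: PU.
have vU : v \in U by exact: PU.
have D0 : det_form w u v != 0 by exact: turn0.
have eD : 0 < e * `|det_form w u v| by rewrite mulr_gt0// normr_gt0.
have Nu := det_form_near w u p eD; have Nv := det_form_near w v p eD.
near=> x => xU.
have ux : `|det_form w u (x - p)| < e * `|det_form w u v| by near: x.
have vx : `|det_form w v (x - p)| < e * `|det_form w u v| by near: x.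
(* The coordinates of x - p in the basis u, v are less than e. *)
pose f := - det_form w v (x - p) / det_form w u v.
pose g := det_form w u (x - p) / det_form w u v.
have fe : `|f| < e by rewrite normrM normfV normrN ltr_pdivrMr ?normr_gt0.
have ge : `|g| < e by rewrite normrM normfV ltr_pdivrMr ?normr_gt0.
have zE : x - p = f *: u + g *: v.
  apply: (scalerI D0); rewrite (det_form_cramer dimU w uU vU xU).
  rewrite (det_formC w _ v) [RHS]scalerDr !scalerA; congr (_ *: _ + _ *: _).
    by rewrite mulrC divfK.
  by rewrite mulrC divfK.
move: fe ge; rewrite !ltr_norml => /andP[f1 f2] /andP[g1 g2].
pose d j : R := c j + f * ((j == S (S i))%:R - (j == S i)%:R)
                + g * ((j == S (S (S i)))%:R - (j == S (S i))%:R).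
have [dE0 dE1 dE2 dE3] : [/\ d i = 0, d (S i) = c (S i) - f,
    d (S (S i)) = c (S (S i)) + f - g & d (S (S (S i))) = c (S (S (S i))) + g].
  rewrite /d ci !(inj_eq (@ordS_inj 4)) !(eq_sym i) !n1 !n2 !n3 !eqxx.
  by rewrite mulr1n mulr0n; split; ring.
exists (\row_j d j); split.
- have [[c1E c2E] c3E] := (ce (S i) (negbT n1), ce (S (S i)) (negbT n2),
                         ce (S (S (S i))) (negbT n3)).
  move=> j; rewrite mxE; elim/(@ordS4P i): j; rewrite ?dE0 ?dE1 ?dE2 ?dE3//; lra.
- under eq_bigr do rewrite mxE.
  move: c1; rewrite !(big_ordS4 _ _ i) /= dE0 dE1 dE2 dE3 ci => <-; ring.
- rewrite -[x](subrK p) zE mulmx_sum_row.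
  under eq_bigr do rewrite mxE.
  move: iE; rewrite !(big_ordS4 _ _ i) /= dE0 dE1 dE2 dE3 ci !scale0r !add0r.
  rewrite /u /v /polygon_edge -/p => ->.
  by apply: row3P; rewrite !mxE; ring.
Unshelve. all: by end_near.
Qed.

(** A negative product produces an inner vertex. If the product is positive,
    the turns at the end points of one of the two edges at each vertex have the
    same sign: the four signs cannot alternate, since opposite turns have the
    same sum. That edge lies on a supporting line. *)
Lemma quad_hull_boundary :
  vertices_on_hull_boundary U P <-> 0 < \prod_j turn w P j.
Proof.
have prod0 : \prod_j turn w P j != 0 by apply/prodf_neq0.
split=> [bd|pos].
  rewrite lt_neqAle eq_sym prod0 /= leNgt; apply/negP.
  case/quad_inner_vertex => i [c [ci c0 c1 iE]].
  exact: bd (inner_hull_neighbourhood ci c0 c1 iE).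
move=> i.
have support (u : 'rV[R]_3) k :
    0 <= det_form w u (row (S i) P - row i P) ->
    0 <= det_form w u (row (S (S i)) P - row i P) ->
    0 <= det_form w u (row (S (S (S i))) P - row i P) ->
    0 < det_form w u (row k P - row i P) ->
    ~ (\forall x \near row i P, x - row i P \in U -> hull P x).
  move=> h1 h2 h3; apply: support_hull_boundary; first exact: PU.
  by apply: (@ordS4P i) => //; rewrite subrr det_form0r.
have [V1 V2 V3] : [/\ det_form w (polygon_edge P i) (row (S i) P - row i P) = 0,
    det_form w (polygon_edge P i) (row (S (S i)) P - row i P) = turn w P i &
    det_form w (polygon_edge P i) (row (S (S (S i))) P - row i P) =
      turn w P (S (S (S i)))].
  split; first exact: det_formvv.
    rewrite /turn /polygon_edge !det_formBr !det_formBl !det_formvv.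
    by rewrite (det_formC w (row (S i) P) (row i P)); ring.
  rewrite /turn ordS4 /polygon_edge ordS4 !det_formBr !det_formBl !det_formvv.
  rewrite (det_formC w (row (S (S (S i))) P) (row (S i) P)).
  rewrite (det_formC w (row (S (S (S i))) P) (row i P)).
  by rewrite (det_formC w (row (S i) P) (row i P)); ring.
(* The edge that ends at the vertex i. *)
pose e := polygon_edge P (S (S (S i))).
have [W1 W2 W3] : [/\
    det_form w e (row (S i) P - row i P) = turn w P (S (S (S i))),
    det_form w e (row (S (S i)) P - row i P) = turn w P (S (S i)) &
    det_form w e (row (S (S (S i))) P - row i P) = 0].
  rewrite /e /turn /polygon_edge !ordS4.
  rewrite !det_formBr !det_formBl !det_formvv.
  rewrite (det_formC w (row (S (S (S i))) P) (row i P)).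
  rewrite (det_formC w (row (S (S (S i))) P) (row (S (S i)) P)).
  rewrite (det_formC w (row (S (S i)) P) (row i P)).
  by split; ring.
have := cyclic_neighbours_sign (quad_turnD w P i); move: pos.
rewrite (big_ordS4 _ _ i) /= => pos /(_ pos)[] [h1 h2].
- by apply: (support (polygon_edge P i) (S (S i))); rewrite ?V1 ?V2 ?V3// ltW.
- apply: (support (- polygon_edge P i) (S (S i)));
    by rewrite det_formNl ?V1 ?V2 ?V3 ?oppr0 ?oppr_ge0 ?oppr_gt0// ltW.
- by apply: (support e (S i)); rewrite ?W1 ?W2 ?W3// ltW.
- apply: (support (- e) (S i));
    by rewrite det_formNl ?W1 ?W2 ?W3 ?oppr0 ?oppr_ge0 ?oppr_gt0// ltW.
Qed.

End QuadConvexPosition.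

(** * Pencils through a strictly convex polygon *)

Section ConvexPolygon.
Variables (R : realType) (n : nat) (U : {vspace 'rV[R]_3}).
Hypotheses (dimU : \dim U = 2%N) (n3 : (3 <= n)%N).
Implicit Types (P Q N Y : 'M[R]_(n, 3)) (w v : 'rV[R]_3) (i j : 'I_n).
Local Notation S := (@ordS n).

Lemma ordS_neq i : S i != i.
Proof.
rewrite -val_eqE /=; case: i => i /= iltn.
have [iS|iS] := ltnP i.+1 n; first by rewrite modn_small// gtn_eqF.
have -> : i.+1 = n by lia.
by rewrite modnn; lia.
Qed.

Lemma ordSS_neq i : S (S i) != i.
Proof.
rewrite -val_eqE /= -[(_ %% n).+1]addn1 modnDml addn1; case: i => i /= iltn.
have [iS|iS] := ltnP i.+2 n; first by rewrite modn_small// gtn_eqF// ltnW.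
have -> : i.+2 = (n + (i.+2 - n))%N by lia.
by rewrite modnDl modn_small; lia.
Qed.

Definition positive_convex w N := forall i j, j != i -> j != S i ->
  0 < det_form w (polygon_edge N i) (row j N - row i N).

(** The orientations at consecutive edges agree, since both are that of the
    triangle formed by these edges. *)
Lemma strictly_convex_orientation w N : strictly_convex_polygon w N ->
  positive_convex w N \/ positive_convex (- w) N.
Proof.
move=> cv.
pose pos i := forall j, j != i -> j != S i ->
  0 < det_form w (polygon_edge N i) (row j N - row i N).
have [[i pi0]|npos] := pselect (exists i, pos i).
  left; apply: (ordS_ind pi0) => j pj; have [//|neg] := cv (S j).
  have := pj (S (S j)); rewrite ordSS_neq ordS_neq => /(_ isT isT).
  have := neg j; rewrite eq_sym ordS_neq eq_sym ordSS_neq => /(_ isT isT).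
  rewrite -[row j N - _]opprB -/(polygon_edge N j) det_formNr -det_formC => t1.
  have -> : row (S (S j)) N - row j N = polygon_edge N j + polygon_edge N (S j).
    by rewrite [RHS]addrC addrA subrK.
  by rewrite det_formDr det_formvv add0r => /(lt_trans t1); rewrite ltxx.
right=> i j ji jS; rewrite det_form_oppw oppr_gt0.
have [pi0|neg] := cv i; last exact: neg.
by case: npos; exists i.
Qed.

Section Convex.
Variables (w : 'rV[R]_3) (N : 'M[R]_(n, 3)).
Hypotheses (wU : w \notin U) (NU : in_plane_parallel_to U N)
  (convN : positive_convex w N).
Local Notation D := (det_form w).
Local Notation e := (polygon_edge N).

Lemma convex_ge0 i j : 0 <= D (e i) (row j N - row i N).
Proof.
have [->|ji] := eqVneq j i; first by rewrite subrr det_form0r.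
have [->|jS] := eqVneq j (S i); first by rewrite det_formvv.
by rewrite ltW// convN.
Qed.

Lemma convex_turn i : 0 < turn w N i.
Proof.
have := convN (ordSS_neq i) (ordS_neq (S i)).
have -> : row (S (S i)) N - row i N = e i + e (S i).
  by rewrite [RHS]addrC addrA subrK.
by rewrite det_formDr det_formvv add0r.
Qed.

Lemma convex_edge_neq0 i : e i != 0.
Proof.
apply: contraTneq (convex_turn i) => e0.
by rewrite /turn e0 det_form0l ltxx.
Qed.

Lemma convex_area i : 0 < area w N.
Proof.
rewrite (area_translate w N (row i N)) pmulr_rgt0 ?invr_gt0//.
have E j : D (row j N - row i N) (row (S j) N - row i N) =
    D (e j) (row i N - row j N).
  rewrite /polygon_edge !det_formBl !det_formBr !det_formvv.
  rewrite (det_formC w (row (S j) N) (row i N)).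
  by rewrite (det_formC w (row (S j) N) (row j N)); ring.
rewrite (bigD1 (S i))//= ltr_wpDr//.
  by apply: sumr_ge0 => j _; rewrite E convex_ge0.
by rewrite E convN// eq_sym ?ordS_neq// ordSS_neq.
Qed.

(** A local minimum of a linear form on the vertices of a convex polygon is a
    strict global minimum: the polygon lies in the angle at the vertex. *)
Lemma convex_local_min v i : D v (e i) < 0 -> 0 < D v (e (S i)) ->
  forall j, j != S i -> D v (row (S i) N) < D v (row j N).
Proof.
move=> v0 v1 j jS; rewrite -subr_gt0 -det_formBr; set z := row j N - _.
have cr := det_form_cramer dimU w (NU (S i) i) (NU (S (S i)) (S i)) (NU j (S i)).
have t0 := convex_turn i.
have E : turn w N i * D v z =
    D (e i) z * D v (e (S i)) - D (e (S i)) z * D v (e i).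
  by rewrite -!det_formZr -det_formBr cr (det_formC _ z) scaleNr addrC.
rewrite -(pmulr_rgt0 _ t0) E subr_gt0.
have z1 : 0 <= D (e (S i)) z := convex_ge0 (S i) j.
have z0E : D (e i) z = D (e i) (row j N - row i N).
  rewrite (_ : row j N - row i N = z + e i); last by rewrite addrA subrK.
  by rewrite det_formDr det_formvv addr0.
have [ji|ji] := eqVneq j i.
  have : 0 < D (e (S i)) z.
    by rewrite convN// ji eq_sym ordSS_neq.
  rewrite z0E ji subrr det_form0r mul0r => zp.
  by rewrite pmulr_rlt0.
have z0 : 0 < D (e i) z by rewrite z0E convN.
by rewrite (le_lt_trans (mulr_ge0_le0 z1 (ltW v0)))// mulr_gt0.
Qed.

Lemma generic_direction i : exists2 v, v \in U & forall j, D v (e j) != 0.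
Proof.
have [b [c [bU cU fr _]]] := plane_basis dimU.
have D0 : D b c != 0 by rewrite (det_form_eq0 wU)// fr.
(* On the line b + t c, each edge excludes one value of t at most. *)
pose t := 1 + \sum_j `|D b (e j) / D c (e j)|.
exists (b + t *: c) => [|j]; first by rewrite memvD// memvZ.
rewrite det_formDl det_formZl.
have [c0|c0] := eqVneq (D c (e j)) 0.
  rewrite c0 mulr0 addr0; apply: contraNneq (convex_edge_neq0 j) => b0.
  apply/eqP/(scalerI D0); rewrite (det_form_cramer dimU w bU cU (NU _ _)).
  by rewrite det_formC c0 b0 oppr0 !scale0r addr0 scaler0.
rewrite -[X in _ + X]opprK subr_eq0; apply/eqP => bE.
have : t = - (D b (e j) / D c (e j)).
  by rewrite bE mulNr opprK mulfK.
have : `|D b (e j) / D c (e j)| <= \sum_j `|D b (e j) / D c (e j)|.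
  by rewrite (bigD1 j)//= lerDl sumr_ge0.
have := ler_norm (- (D b (e j) / D c (e j))); rewrite normrN /t.
lra.
Qed.

(** Integrating x dh along the sides of Y, where h is a height function that is
    constant on none of them, and summing by parts gives the area as a weighted
    sum of the squared heights of the vertices. *)
Lemma area_heights v Y (y : 'I_n -> R) i : v \in U ->
  (forall j, D v (e j) != 0) ->
  in_plane_parallel_to U Y -> (forall j, polygon_edge Y j = y j *: e j) ->
  2 * area w Y = - \sum_j turn w N j / (D v (e j) * D v (e (S j))) *
                     D v (row (S j) Y - row i Y) ^+ 2.
Proof.
move=> vU ve YU YN.
rewrite (area_translate w Y (row i Y)) mulVKf ?pnatr_eq0//.
set h := fun j => D v (row j Y - row i Y).
pose x j := D (e i) (row j Y - row i Y).
(* The slope dx/dh of the j-th edge. *)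
pose s j := D (e i) (e j) / D v (e j).
have eU j : e j \in U := NU (S j) j.
have c0 : D v (e i) != 0 := ve i.
apply: (mulfI c0); rewrite mulrN mulr_sumr.
have hS j : h (S j) = h j + y j * D v (e j).
  rewrite /h -det_formZr -YN -det_formDr; congr (D _ _).
  by rewrite [RHS]addrC addrA subrK.
have xS j : x (S j) = x j + y j * D (e i) (e j).
  rewrite /x -det_formZr -YN -det_formDr; congr (D _ _).
  by rewrite [RHS]addrC addrA subrK.
transitivity (\sum_j ((x j * h j - x (S j) * h (S j)) +
                      (s j * h (S j) ^+ 2 - s j * h j ^+ 2))).
  apply: eq_bigr => j _.
  rewrite (det_form_plucker dimU _ _ vU (eU i) (YU j i)).
  rewrite (det_formC w _ (e i)) -/(h j) -/(x j) -/(h (S j)) -/(x (S j)).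
  by rewrite hS xS /s; field.
rewrite big_split /= !sumrB (sum_ordS (fun j => x j * h j)) subrr add0r.
rewrite -(sum_ordS (fun j => s j * h j ^+ 2)) -sumrB mulr_sumr -sumrN.
apply: eq_bigr => j _; rewrite -/(h (S j)) -mulrBl.
rewrite [D v (e i) * (_ * _)]mulrA -[RHS]mulNr; congr (_ * _).
have pl := det_form_plucker dimU w (e (S j)) vU (eU i) (eU j).
rewrite -/(turn w N j) in pl.
rewrite mulrA pl /s (det_formC w (e j) (e i)).
by field; rewrite !ve.
Qed.

Lemma area_const Y t : (forall j, row j Y = t) -> area w Y = 0.
Proof.
move=> Yt; rewrite (@area_homothetic _ _ w Y Y 0 t) ?expr0n ?mul0r// => j.
by rewrite scale0r add0r.
Qed.

(** Every pencil of polygons through N contains one with the lowest and highest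
    vertices of N at the same height. All other vertices have positive weight in
    the formula for its area. *)
Lemma pencil_nonpos_area P Q a b i : in_plane_parallel_to U P ->
  in_plane_parallel_to U Q -> parallel_polygons P Q -> N = a *: P + b *: Q ->
  exists p q : R, [/\ (p, q) != (0, 0), area w (p *: P + q *: Q) <= 0 &
    area w (p *: P + q *: Q) = 0 ->
    exists t, forall j, row j (p *: P + q *: Q) = t].
Proof.
move=> PU QU PQ NE.
have [v vU ve] := generic_direction i.
pose k j := D v (row j N).
have [lo lomin] : exists lo, forall j, k lo <= k j.
  by exists [arg min_(j < i) k j]%O; case: arg_minP => // lo _ h j; apply: h.
have [hi himax] : exists hi, forall j, k j <= k hi.
  by exists [arg max_(j > i) k j]%O; case: arg_maxP => // hi _ h j; apply: h.
pose p := D v (row hi P - row lo P); pose q := D v (row hi Q - row lo Q).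
pose Y := q *: P + (- p) *: Q.
exists q, (- p); rewrite -/Y.
have YU : in_plane_parallel_to U Y := lincomb_in_plane q (- p) PU QU.
have [y yE] : exists y : 'I_n -> R, forall j, polygon_edge Y j = y j *: e j.
  have [|l [m []]] := @parallel_edges _ _ P Q a b PQ.
    by rewrite -NE; exact: convex_edge_neq0.
  rewrite -NE => PN QN; exists (fun j => q * l j + (- p) * m j) => j.
  by rewrite polygon_edgeD_scale PN QN !scalerA -scalerDl.
have A := area_heights lo vU ve YU yE.
have hhi : D v (row hi Y - row lo Y) = 0.
  rewrite !rowD_scale opprD addrACA -!scalerBr det_formDr !det_formZr.
  by rewrite -/p -/q mulNr mulrC subrr.
have hlo : D v (row lo Y - row lo Y) = 0 by rewrite subrr det_form0r.
have term j : D v (row (S j) Y - row lo Y) = 0 \/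
    0 < turn w N j / (D v (e j) * D v (e (S j))).
  have [eS|eS] := ltP 0 (D v (e j) * D v (e (S j))).
    by right; rewrite divr_gt0// convex_turn.
  left; have {}eS : D v (e j) * D v (e (S j)) < 0.
    by rewrite lt_neqAle eS mulf_neq0.
  have := ve j; rewrite neq_lt => /orP[vj|vj].
    have vSj : 0 < D v (e (S j)) by move: eS; rewrite nmulr_rlt0.
    have [<- //|loS] := eqVneq lo (S j).
    by have := convex_local_min vj vSj loS; rewrite ltNge lomin.
  have vSj : D v (e (S j)) < 0 by move: eS; rewrite pmulr_rlt0.
  have [<- //|hiS] := eqVneq hi (S j).
  have := @convex_local_min (- v) j.
  rewrite !det_formNl oppr_lt0 oppr_gt0 => /(_ vj vSj _ hiS).
  by rewrite det_formNl ltrN2 ltNge himax.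
have term0 j : 0 <= turn w N j / (D v (e j) * D v (e (S j))) *
                     D v (row (S j) Y - row lo Y) ^+ 2.
  have [->|t0] := term j; first by rewrite expr0n mulr0.
  by rewrite mulr_ge0 ?sqr_ge0// ltW.
split.
- apply/negP => /eqP[q0 /eqP]; rewrite oppr_eq0 => /eqP p0.
  have kk : k hi = k lo.
    apply/eqP; rewrite -subr_eq0 /k -det_formBr NE !rowD_scale opprD addrACA.
    by rewrite -!scalerBr det_formDr !det_formZr -/p -/q p0 q0 !mulr0 addr0.
  have kc j : k j = k lo by apply/eqP; rewrite eq_le lomin -kk himax.
  by have := ve i; rewrite det_formBr -!/(k _) !kc subrr eqxx.
- have : 0 <= - (2 * area w Y) by rewrite A opprK sumr_ge0.
  by rewrite oppr_ge0 pmulr_rle0.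
- move=> A0; move/eqP: A; rewrite A0 mulr0 eq_sym oppr_eq0 psumr_eq0//.
  move=> /allP Y0.
  have h0 j : D v (row (S j) Y - row lo Y) = 0.
    have [//|t0] := term j.
    have := Y0 j (mem_index_enum _); rewrite mulf_eq0 gt_eqF//= expf_eq0 /=.
    by move/eqP.
  have h0' j : D v (row j Y - row lo Y) = 0 by rewrite -(ord_predK j) h0.
  exists (row lo Y); apply: polygon_edge0_const => j.
  have : D v (polygon_edge Y j) = 0.
    rewrite /polygon_edge -[row (S j) Y](subrK (row lo Y)) -addrA det_formDr h0.
    by rewrite -opprB det_formNr h0' oppr0 addr0.
  rewrite yE det_formZr => /eqP; rewrite mulf_eq0 (negPf (ve j)) orbF => /eqP->.
  by rewrite scale0r.
Qed.

(** The area form on the pencil is positive on N and nonpositive on another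
    member, so it is not definite. If it is degenerate, it is positive
    semidefinite, so that the other member has area zero and is a point. *)
Lemma positive_convex_disc P Q a b : in_plane_parallel_to U P ->
  in_plane_parallel_to U Q -> parallel_polygons P Q -> N = a *: P + b *: Q ->
  area w P != 0 ->
  0 <= area_disc w P Q /\ (area_disc w P Q = 0 -> homothetic P Q).
Proof.
move=> PU QU PQ NE areaP.
have i : 'I_n by exists 0%N; exact: leq_trans n3.
have [p [q [pq0 AY AY0]]] := pencil_nonpos_area i PU QU PQ NE.
have AN := convex_area i.
have DN := area_disc_lincomb w P Q a b; rewrite -NE in DN.
have DY := area_disc_lincomb w P Q p q.
set A := area w P in areaP DN DY; set d := area_disc w P Q in DN DY *.
set M := mixed_area w P Q in DN DY.
have Apos : d <= 0 -> 0 < A.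
  move=> d0; rewrite lt_neqAle eq_sym areaP /=.
  rewrite -(pmulr_lge0 _ AN) DN -mulrN.
  by rewrite addr_ge0 ?sqr_ge0// mulr_ge0 ?sqr_ge0// oppr_ge0.
have Yzero : d <= 0 -> area w (p *: P + q *: Q) = 0.
  move=> d0; apply/eqP; rewrite eq_le AY /= -(pmulr_rge0 _ (Apos d0)) DY -mulrN.
  by rewrite addr_ge0 ?sqr_ge0// mulr_ge0 ?sqr_ge0// oppr_ge0.
split=> [|d0].
  rewrite leNgt; apply/negP => d0.
  move/eqP: DY; rewrite Yzero ?ltW// mulr0 eq_sym subr_eq0 => /eqP DY.
  have q0 : q = 0.
    have := sqr_ge0 (p * A + q * M); rewrite DY nmulr_lge0// => q0.
    by apply/eqP; rewrite -sqrf_eq0 eq_le q0 sqr_ge0.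
  move/eqP: DY; rewrite q0 expr0n mul0r mul0r addr0 sqrf_eq0 mulf_eq0.
  rewrite (negPf areaP) orbF => /eqP p0.
  by move: pq0; rewrite p0 q0 eqxx.
have [|t Yt] := AY0 _; first by rewrite Yzero// d0.
have [q0|q0] := eqVneq q 0.
  have p0 : p != 0 by apply: contraNneq pq0 => ->; rewrite q0.
  case/eqP: areaP; apply: (@area_const P (p^-1 *: t)) => j.
  by rewrite -(Yt j) rowD_scale q0 scale0r addr0 scalerK.
exists (- (q^-1 * p)), (q^-1 *: t) => j.
rewrite -(Yt j) rowD_scale scalerDr scalerK// !scalerA scaleNr.
by rewrite addrA addNr add0r.
Qed.

End Convex.

Lemma strictly_convex_disc w P Q a b : w \notin U -> in_plane_parallel_to U P ->
  in_plane_parallel_to U Q -> parallel_polygons P Q ->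
  strictly_convex_polygon w (a *: P + b *: Q) -> area w P != 0 ->
  0 <= area_disc w P Q /\ (area_disc w P Q = 0 -> homothetic P Q).
Proof.
move=> wU PU QU PQ cv areaP.
have NU := lincomb_in_plane a b PU QU.
have areaN P' : area (- w) P' = - area w P'.
  by rewrite /area -mulrN -sumrN; under eq_bigr do rewrite det_form_oppw.
have [cN|cN] := strictly_convex_orientation cv.
  exact: (positive_convex_disc wU NU cN PU QU PQ erefl areaP).
have -> : area_disc w P Q = area_disc (- w) P Q.
  by rewrite /area_disc /mixed_area !areaN; ring.
apply: (positive_convex_disc _ NU cN PU QU PQ erefl).
  by rewrite memvN.
by rewrite areaN oppr_eq0.
Qed.

End ConvexPolygon.

(** * Quadrilaterals inscribed in a strictly convex surface *)

Section StrictlyConvexSurface.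
Variables (R : realType) (Sigma : set 'rV[R]_3).
Hypothesis convS : strictly_convex_surface Sigma.
Implicit Types x y z : 'rV[R]_3.

Lemma surface_segment x y t : Sigma x -> Sigma y -> x != y -> 0 < t < 1 ->
  ~ Sigma (t *: x + (1 - t) *: y).
Proof.
have [K [clK _ cvK ->]] := convS.
rewrite -(closure_id K).1// => -[Kx _] [Ky _] xy t01 [_].
by apply; exact: cvK.
Qed.

Lemma surface_triangle x y z (a b c : R) : Sigma x -> Sigma y -> Sigma z ->
  0 < a -> 0 < b -> 0 < c -> a + b + c = 1 ->
  a *: x + b *: y + c *: z != x -> ~ Sigma (a *: x + b *: y + c *: z).
Proof.
have [K [clK _ cvK ->]] := convS.
rewrite -(closure_id K).1// => -[Kx _] [Ky _] [Kz _] a0 b0 c0 abc1 ne [_].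
have bc0 : 0 < b + c by rewrite addr_gt0.
have aE : 1 - a = b + c by rewrite -abc1; ring.
pose u := (b / (b + c)) *: y + (1 - b / (b + c)) *: z.
have bcE : 1 - b / (b + c) = c / (b + c) by field; rewrite gt_eqF.
have Ku : K u.
  rewrite /u; have [->|yz] := eqVneq y z.
    by rewrite -scalerDl subrKC scale1r.
  apply: interior_subset; apply: cvK => //.
  by rewrite divr_gt0//= ltr_pdivrMr// mul1r ltrDl.
have E : a *: x + b *: y + c *: z = a *: x + (1 - a) *: u.
  rewrite /u bcE aE scalerDr !scalerA ![(b + c) * _]mulrC !divfK ?gt_eqF//.
  by rewrite addrA.
rewrite E in ne *; apply; apply: cvK => //; last first.
  by rewrite a0/= -subr_gt0 aE.
apply: contraNneq ne => <-.
by rewrite -scalerDl addrC subrK scale1r.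
Qed.

(** Of three distinct points on a line, one lies between the other two. What
    remains is m = -1, where the first and the third coincide. *)
Lemma surface_line x u m : Sigma x -> Sigma (x + u) -> Sigma (x + u + m *: u) ->
  u != 0 -> m != 0 -> m = -1.
Proof.
move=> Sx Sy Sz u0 m0; apply: contrapT => m1.
have D (a b : R) : a != b -> x + a *: u != x + b *: u.
  move=> ab; rewrite (inj_eq (addrI x)) -subr_eq0 -scalerBl scaler_eq0.
  by rewrite (negPf u0) orbF subr_eq0.
have yE : x + u = x + 1 *: u by rewrite scale1r.
have zE : x + u + m *: u = x + (1 + m) *: u by rewrite scalerDl scale1r addrA.
have xE : x = x + 0 *: u by rewrite scale0r addr0.
have comb (t a b : R) : t *: (x + a *: u) + (1 - t) *: (x + b *: u) =
    x + (t * a + (1 - t) * b) *: u.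
  by apply: row3P; rewrite !mxE; ring.
rewrite zE in Sz; rewrite yE in Sy; rewrite xE in Sx.
have [mpos|mneg] := ltP 0 m.
  apply: (@surface_segment _ _ (m / (1 + m)) Sx Sz).
  - by apply: D; rewrite eq_sym gt_eqF// addr_gt0.
  - by rewrite divr_gt0 ?addr_gt0//= ltr_pdivrMr ?addr_gt0// mul1r ltrDr.
  - rewrite comb (_ : _ + _ = 1)//; field.
    by rewrite gt_eqF// addr_gt0.
have {}mneg : m < 0 by rewrite lt_neqAle m0.
have [m1'|m1'] := ltP (-1) m.
  apply: (@surface_segment _ _ (- m) Sx Sy).
  - by apply: D; rewrite eq_sym oner_eq0.
  - by rewrite oppr_gt0 mneg/= ltrNl.
  - by rewrite comb (_ : _ + _ = 1 + m)//; ring.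
have {}m1' : m < -1 by rewrite lt_neqAle m1' andbT; apply/eqP.
apply: (@surface_segment _ _ (1 + m^-1) Sy Sz).
- by apply: D; rewrite -subr_eq0 opprD addrA subrr sub0r oppr_eq0.
- have mi : m^-1 < 0 by rewrite invr_lt0.
  have mi1 : -1 < m^-1 by rewrite -[-1]invrN1 ltf_nV2// ?qualifE/=; lra.
  by apply/andP; split; lra.
- by rewrite comb (_ : (1 + m^-1) * 1 + _ = 0)//; field.
Qed.

End StrictlyConvexSurface.

Section InscribedQuad.
Variables (R : realType) (w : 'rV[R]_3) (U : {vspace 'rV[R]_3}).
Hypotheses (dimU : \dim U = 2%N) (wU : w \notin U).
Variables (Sigma : set 'rV[R]_3) (P Q : 'M[R]_(4, 3)) (l : 'I_4 -> R).
Hypotheses (convS : strictly_convex_surface Sigma)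
  (QS : forall i, Sigma (row i Q)) (QU : in_plane_parallel_to U Q)
  (Q0 : forall i, polygon_edge Q i != 0)
  (PQ : forall i, polygon_edge P i = l i *: polygon_edge Q i)
  (areaP : area w P != 0).
Local Notation S := (@ordS 4).

(** Three distinct points of the surface are not collinear. If the vertices i
    and i + 2 of Q coincide, its edges come in two pairs of parallels, and both
    triangles into which a diagonal divides P are degenerate. *)
Lemma inscribed_turn_neq0 i : turn w Q i != 0.
Proof.
apply/negP => t0.
have := t0; rewrite /turn (det_form_eq0 wU (QU _ _) (QU _ _)).
move=> /(@parallel_combination _ 1 0); rewrite scale1r scale0r addr0.
move=> /(_ (Q0 i))[_ [m [_]]]; rewrite -!/(polygon_edge Q _) => mE.
have E1 : row (S i) Q = row i Q + polygon_edge Q i by rewrite addrC subrK.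
have E2 : row (S (S i)) Q = row i Q + polygon_edge Q i + m *: polygon_edge Q i.
  by rewrite -mE -E1 addrC subrK.
have m0 : m != 0 by apply: contraNneq (Q0 (S i)) => m0; rewrite mE m0 scale0r.
have m1 : m = -1.
  apply: (surface_line convS (QS i) _ _ (Q0 i) m0); first by rewrite -E1.
  by rewrite -E2.
case/eqP: areaP; apply: (@mulfI _ 2); rewrite ?pnatr_eq0//.
rewrite mulr0 (quad_area w P i).
rewrite /turn !PQ !det_formZl !det_formZr -!/(turn w Q _) (eqP t0) !mulr0 add0r.
rewrite /turn quad_last_edge mE m1 scaleN1r subrr add0r det_formNr det_formvv.
by rewrite oppr0 !mulr0.
Qed.

(** Otherwise some vertex of Q would be in the interior of the convex body, in
    a triangle formed by three of its points. *)
Lemma inscribed_turn_prod : 0 < \prod_i turn w Q i.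
Proof.
have prod0 : \prod_j turn w Q j != 0.
  by apply/prodf_neq0 => i _; exact: inscribed_turn_neq0.
rewrite lt_neqAle eq_sym prod0 /= leNgt; apply/negP.
case/(quad_inner_vertex dimU QU) => i [c [ci c0]].
have [n1 n2 n3] := ordS4_neq i.
rewrite !(big_ordS4 _ _ i) /= ci scale0r !add0r => c1 iE.
have := QS i; rewrite iE; apply: surface_triangle => //;
  rewrite ?c0 ?n1 ?n2 ?n3//.
rewrite -iE; apply: contraNneq (Q0 i) => iS.
by rewrite /polygon_edge -iS subrr.
Qed.

End InscribedQuad.

(** * Principal curvatures of a face *)

Section Face.
Variables (R : realType) (n : nat) (w : 'rV[R]_3) (U : {vspace 'rV[R]_3}).
Hypotheses (dimU : \dim U = 2%N) (wU : w \notin U).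
Variables P Q : 'M[R]_(n, 3).
Hypotheses (PU : in_plane_parallel_to U P) (QU : in_plane_parallel_to U Q)
  (PQ : parallel_polygons P Q) (areaP : area w P != 0).

Lemma area_edge_neq0 : exists i, polygon_edge P i != 0.
Proof.
apply: contrapT => no; case/eqP: areaP.
have P0 j : polygon_edge P j = 0.
  by apply/eqP; apply: contrapT => /negP Pj; apply: no; exists j.
rewrite /area big1 ?mulr0// => i _.
have PE j : row j P = row i P by exact: polygon_edge0_const.
by rewrite (PE (ordS i)) det_formvv.
Qed.

Lemma related_by_similarityP : related_by_similarity U P Q <-> homothetic P Q.
Proof.
have [i i0] := area_edge_neq0.
split; first exact: (similar_homothetic dimU wU PU PQ i0).
exact: (homothetic_similar dimU wU i PU).
Qed.

Lemma area_disc0P : (area_disc w P Q = 0 -> homothetic P Q) ->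
  area_disc w P Q = 0 <-> related_by_similarity U P Q.
Proof.
move=> h; split=> [/h|]; first by move/related_by_similarityP.
by move/related_by_similarityP; exact: homothetic_area_disc.
Qed.

Lemma convex_face_curvatures : (3 <= n)%N ->
  (exists a b : R, strictly_convex_polygon w (a *: P + b *: Q)) ->
  exists k1 k2 : R, are_principal_curvatures w P Q k1 k2 /\
    (k1 = k2 <-> related_by_similarity U P Q).
Proof.
move=> n3 [a [b cv]].
have [D0 Dh] := strictly_convex_disc dimU n3 wU PU QU PQ cv areaP.
exact: (principal_curvatures_similar areaP D0 (area_disc0P Dh)).
Qed.

End Face.

Section QuadFace.
Variables (R : realType) (n : nat) (w : 'rV[R]_3) (U : {vspace 'rV[R]_3}).
Hypotheses (dimU : \dim U = 2%N) (wU : w \notin U).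
Variables P Q : 'M[R]_(n, 3).
Hypotheses (PU : in_plane_parallel_to U P) (QU : in_plane_parallel_to U Q)
  (PQ : parallel_polygons P Q) (areaP : area w P != 0) (n4 : n = 4%N).

Lemma nondegenerate_turn (N : 'M[R]_(n, 3)) : in_plane_parallel_to U N ->
  nondegenerate_polygon N -> forall i, turn w N i != 0.
Proof.
by move=> NU nd i; rewrite (det_form_eq0 wU (NU _ _) (NU _ _)) negbK; exact: nd.
Qed.

Lemma quad_face_umbilic :
  (exists a b : R, nondegenerate_polygon (a *: P + b *: Q)) ->
  (exists k : R, are_principal_curvatures w P Q k k) <->
  related_by_similarity U P Q.
Proof.
move=> [a [b nd]].
have NU := lincomb_in_plane a b PU QU.
have t0 := nondegenerate_turn NU nd.
rewrite (double_principal_curvature Q areaP).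
apply: area_disc0P => //; subst n.
exact: (quad_disc0_homothetic dimU erefl NU PQ t0 areaP).
Qed.

(** The discriminant has the sign of the product of the turns of P, and that of
    the product of the turns of Q. So the conditions on the vertices of P and of
    Q are equivalent. *)
Lemma quad_face_existence :
  nondegenerate_polygon P -> nondegenerate_polygon Q ->
  ~ related_by_similarity U P Q ->
  principal_curvatures_exist w P Q <->
  vertices_on_hull_boundary U P \/ vertices_on_hull_boundary U Q.
Proof.
move=> ndP ndQ; rewrite (related_by_similarityP dimU wU PU PQ areaP) => nh.
have tP := nondegenerate_turn PU ndP; have tQ := nondegenerate_turn QU ndQ.
rewrite (principal_curvatures_existP Q areaP); subst n.
rewrite (quad_hull_boundary dimU PU tP) (quad_hull_boundary dimU QU tQ).
have PE : P = 1 *: P + 0 *: Q by rewrite scale1r scale0r addr0.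
have QE : Q = 0 *: P + 1 *: Q by rewrite scale1r scale0r add0r.
rewrite -(quad_disc_ge0 dimU PE PU PQ tP areaP nh).
rewrite -(quad_disc_ge0 dimU QE QU PQ tQ areaP nh).
by tauto.
Qed.

Lemma inscribed_quad_curvatures (Sigma : set 'rV[R]_3) :
  strictly_convex_surface Sigma -> (forall i, Sigma (row i Q)) ->
  (forall i, polygon_edge Q i != 0) ->
  exists k1 k2 : R, are_principal_curvatures w P Q k1 k2 /\
    (k1 = k2 <-> related_by_similarity U P Q).
Proof.
move=> convS QS Q0.
have QE : Q = 0 *: P + 1 *: Q by rewrite scale1r scale0r add0r.
have [|l [_ [lE _]]] := @parallel_edges _ _ P Q 0 1 PQ; first by rewrite -QE.
rewrite -QE in lE.
have [D0 Dh] : 0 <= area_disc w P Q /\ (area_disc w P Q = 0 -> homothetic P Q).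
  subst n; have t0 := inscribed_turn_neq0 wU convS QS QU Q0 lE areaP.
  have pos := inscribed_turn_prod dimU wU convS QS QU Q0 lE areaP.
  split; last exact: (quad_disc0_homothetic dimU QE QU PQ t0 areaP).
  have [/(homothetic_area_disc w) -> //|nh] := pselect (homothetic P Q).
  exact/(quad_disc_ge0 dimU QE QU PQ t0 areaP nh).
apply: (principal_curvatures_similar areaP D0).
exact: (area_disc0P dimU wU PU PQ areaP Dh).
Qed.

End QuadFace.

Theorem proposition9 (R : realType) (C : mesh_combinatorics) (m s : mesh R C)
    (U : face C -> {vspace 'rV[R]_3}) (w : face C -> 'rV[R]_3)
    (polyhedral_m : polyhedral_surface m)
    (parallel_ms : parallel_meshes m s)
    (dim_U : forall f, \dim (U f) = 2%N)
    (m_in_U : forall f, in_plane_parallel_to (U f) (face_polygon m f))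
    (s_in_U : forall f, in_plane_parallel_to (U f) (face_polygon s f))
    (w_notin_U : forall f, w f \notin U f)
    (curvatures_defined : forall f, area (w f) (face_polygon m f) != 0) :
  [/\ (* 1 *)
      forall f : face C, arity f = 4%N ->
        ((exists a b : R,
            nondegenerate_polygon (a *: face_polygon m f + b *: face_polygon s f)) ->
         ((exists k : R,
             are_principal_curvatures (w f) (face_polygon m f) (face_polygon s f)
               k k) <->
          related_by_similarity (U f) (face_polygon m f) (face_polygon s f))) /\
        (nondegenerate_polygon (face_polygon m f) -> nondegenerate_polygon (face_polygon s f) ->
         ~ related_by_similarity (U f) (face_polygon m f) (face_polygon s f) ->
         (principal_curvatures_exist (w f) (face_polygon m f) (face_polygon s f)
          <->
          vertices_on_hull_boundary (U f) (face_polygon m f) \/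
          vertices_on_hull_boundary (U f) (face_polygon s f))),
      (* 2 *)
      forall f : face C,
        (exists a b : R, strictly_convex_polygon (w f)
           (a *: face_polygon m f + b *: face_polygon s f)) ->
        exists k1 k2 : R,
          are_principal_curvatures (w f) (face_polygon m f) (face_polygon s f)
            k1 k2 /\
          (k1 = k2 <->
           related_by_similarity (U f) (face_polygon m f) (face_polygon s f)) &
      (* 3 *)
      forall (Sigma : set 'rV[R]_3), strictly_convex_surface Sigma ->
        inscribed s Sigma ->
        forall f : face C, arity f = 4%N ->
        (forall i : 'I_(arity f), polygon_edge (face_polygon s f) i != 0) ->
        exists k1 k2 : R,
          are_principal_curvatures (w f) (face_polygon m f) (face_polygon s f)
            k1 k2 /\
          (k1 = k2 <->
           related_by_similarity (U f) (face_polygon m f) (face_polygon s f))].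
Proof.
have PQ f : parallel_polygons (face_polygon m f) (face_polygon s f).
  move=> i; rewrite /polygon_edge !rowK; apply: parallel_ms.
  by rewrite edge_symmetric corner_edge.
split=> [f f4|f|Sigma convS sS f f4 Q0].
- split.
    exact: (quad_face_umbilic (dim_U f) (w_notin_U f) (m_in_U f) (s_in_U f)).
  exact: (quad_face_existence (dim_U f) (w_notin_U f) (m_in_U f) (s_in_U f)).
- exact: (convex_face_curvatures (dim_U f) (w_notin_U f) (m_in_U f) (s_in_U f)
    (PQ f) (curvatures_defined f) (arity_ge3 f)).
- apply: (inscribed_quad_curvatures (dim_U f) (w_notin_U f) (m_in_U f)
    (s_in_U f) (PQ f) (curvatures_defined f) f4 convS) => // i.
  by rewrite rowK; exact: sS.
Qed.
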